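(* Let $d\in\mathbb{N}$, let $A\in\mathscr{R}$ be a fixed set, and let ${\bf D}_r(t)=\sum_{i=1}^{N(t)}{\bf X}^{(i)}e^{-r\tau_i}$ be the discounted aggregate claims, where $\{{\bf X}^{(i)}\}_{i\in\mathbb{N}}$ are i.i.d. non-negative $d$-dimensional claim vectors with common distribution $F$ (generic copy ${\bf X}$) and $\{N(t),\,t\ge0\}$ is a renewal counting process with arrival times $\{\tau_i\}$, inter-arrival times $\{\theta_i\}$ and finite renewal function $\lambda(t)=\mathbf{E}[N(t)]$. Assume that the sequence $\{{\bf X}^{(i)},\,i\in\mathbb{N}\}$ and the process $\{N(t),\,t\ge0\}$ are independent, that $F\in\mathcal{A}_A$, that there exists $\varepsilon>0$ with $\mathbf{P}[\theta_1>\varepsilon]=1$, and that $r>0$. Then $$\mathbf{P}\left[{\bf D}_r(t)\in x\,A\right]\sim\int_0^t\mathbf{P}\left[{\bf X}\in x\,e^{rs}A\right]\lambda(ds),\qquad x\to\infty,$$ uniformly for all $t\in\Lambda$.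
   Context: Model. The claim vectors ${\bf X}^{(i)}=(X^{(i)}_1,\dots,X^{(i)}_d)$, $i\in\mathbb{N}$, take values in $[0,\infty)^d$; they may have some zero components but not all components equal to zero. The components of one vector may be arbitrarily dependent. The $i$-th claim vector arrives at time $\tau_i$, with $\tau_0=0$; the inter-arrival times $\theta_i=\tau_i-\tau_{i-1}$, $i\ge1$, are i.i.d., non-negative and not degenerate at zero. $N(t)=\sup\{n:\tau_n\le t\}$ and $\lambda(t)=\mathbf{E}[N(t)]=\sum_{i=1}^\infty\mathbf{P}[\tau_i\le t]<\infty$. $\Lambda=\{t\ge0:\lambda(t)>0\}=\{t\ge 0:\mathbf{P}[\tau_1\le t]>0\}$. Integrals $\int_0^t\cdot\,\lambda(ds)$ are with respect to the measure $B\mapsto\sum_{i\ge1}\mathbf{P}[\tau_i\in B]$ on $[0,t]$. Sets. $\mathscr{R}$ is the family of all sets $A\subsetneq\mathbb{R}^d$ that are open, increasing (i.e. ${\bf x}\in A$ and ${\bf y}\in[0,\infty)^d$ imply ${\bf x}+{\bf y}\in A$), have convex complement $A^c$, and satisfy ${\bf 0}\notin\overline{A}$. For $x>0$, $xA=\{x{\bf a}:{\bf a}\in A\}$. Distribution classes. For $A\in\mathscr{R}$ and a random vector ${\bf X}$ in $[0,\infty)^d$ with distribution $F$, let $Y_A=\sup\{u>0:{\bf X}\in uA\}$ (with $\sup\emptyset=0$), and let $F_A$ be the distribution of $Y_A$; its tail is $\overline{F}_A(x)=1-F_A(x)=\mathbf{P}[{\bf X}\in xA]$ for $x>0$. All univariate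 distributions $V$ in the classes considered satisfy $\overline V(x)>0$ for all $x$. $F\in\mathcal{A}_A$ means that $F_A\in\mathcal{A}=\mathcal{S}\cap\mathcal{P_D}$, i.e. both: (1) $F_A$ is subexponential: $\lim_{x\to\infty}\overline{F_A^{n*}}(x)/\overline{F}_A(x)=n$ for any (equivalently, some) integer $n\ge2$, where $F_A^{n*}$ is the $n$-fold convolution of $F_A$; and (2) $F_A$ is positively decreasing: $\limsup_{x\to\infty}\overline{F}_A(vx)/\overline{F}_A(x)<1$ for some $v>1$. Uniformity. $f(x,t)\sim g(x,t)$ uniformly for $t\in E$ means $\lim_{x\to\infty}\sup_{t\in E}\left|f(x,t)/g(x,t)-1\right|=0$. *)

(* Defs.v *)
From HB Require Import structures.
From mathcomp Require Import all_boot all_order all_algebra.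
From mathcomp Require Import all_classical all_reals all_analysis.
From mathcomp Require Import measurable_realfun.

Set Implicit Arguments.
Unset Strict Implicit.
Unset Printing Implicit Defensive.

Import Order.TTheory GRing.Theory Num.Theory.
Import numFieldNormedType.Exports.

Local Open Scope classical_set_scope.
Local Open Scope ring_scope.

(* R^d with its Borel sigma-algebra; convertible to 'rV[R]_d. *)
Definition borel_rV (R : realType) (d : nat) :=
  g_sigma_algebraType (@open 'rV[R]_d).

Section sets.
Context {R : realType} {d : nat}.
Implicit Types (A : set 'rV[R]_d) (x y : 'rV[R]_d) (u : R).

Definition nonneg_rV x := forall j, 0 <= x ord0 j.

Definition dilate u A : set 'rV[R]_d := [set u *: a | a in A].

Definition increasing_set A := forall x y, A x -> nonneg_rV y -> A (x + y).

Definition risk_set A :=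
  [/\ A != setT, open A, increasing_set A,
      convex_set (~` A) & ~ closure A 0].

(* The real [sup] agrees with the supremum in the extended reals here: when
   [risk_set A] holds the set below is bounded, and [sup set0 = 0]. *)
Definition radial A (x : borel_rV R d) : R :=
  sup [set u | 0 < u /\ dilate u A x].

Lemma dilateE u A : 0 < u -> dilate u A = ( *:%R u^-1) @^-1` A.
Proof.
move=> u0; apply/seteqP; split => x /=.
  by move=> [a Aa <-]; rewrite scalerA mulVf ?gt_eqF// scale1r.
by move=> Ax; exists (u^-1 *: x) => //; rewrite scalerA divff ?gt_eqF// scale1r.
Qed.

Lemma open_dilate u A : 0 < u -> open A -> open (dilate u A).
Proof.
move=> u0 oA; rewrite dilateE//; apply: open_comp => // x _.
exact: scaler_continuous.
Qed.

Lemma radial_bounded A : ~ closure A 0 ->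
  forall x, has_ubound [set u | 0 < u /\ dilate u A x].
Proof.
move=> cA x.
have [e e0 eA] : exists2 e : R, 0 < e & forall a, A a -> e <= `|a|.
  move/existsNP : cA => [B /not_implyP[nB AB]].
  move/nbhs_norm0P : nB => [e/= e0 eB]; exists e => // a Aa.
  rewrite leNgt; apply/negP => ae; apply: AB; exists a; split => //.
  exact: eB.
exists (`|x| / e) => u /= [u0 [a Aa <-]].
by rewrite normrZ (gtr0_norm u0) ler_pdivlMr// ler_wpM2l ?(ltW u0)// eA.
Qed.

Lemma radial_ge0 A x : 0 <= radial A x.
Proof.
rewrite /radial.
have [[[u Eu] ubE]|/sup_out -> //] :=
  pselect (has_sup [set u | 0 < u /\ dilate u A x]).
by apply: (le_trans (ltW Eu.1)); exact: ub_le_sup.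
Qed.

Lemma measurable_radial A :
  risk_set A -> measurable_fun [set: borel_rV R d] (radial A).
Proof.
move=> [_ oA _ _ cA].
apply: (measurability _ (RGenOInfty.measurableE R)).
move=> _ [_ [c ->] <-]; rewrite setTI.
have [c0|c0] := ltP c 0.
  rewrite (_ : _ @^-1` _ = setT); first exact: measurableT.
  apply/seteqP; split => // x _ /=; rewrite in_itv/= andbT (lt_le_trans c0)//.
  exact: radial_ge0.
apply: sub_sigma_algebra.
rewrite (_ : _ @^-1` _ = \bigcup_(u in [set u | c < u]) dilate u A).
  apply: bigcup_open => u /= cu.
  by apply: open_dilate => //; exact: le_lt_trans cu.
apply/seteqP; split => x /=; rewrite in_itv/= andbT.
  move=> cx.
  have [E0|/set0P E0] := eqVneq [set u | 0 < u /\ dilate u A x] set0.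
    by move: cx; rewrite /radial E0 sup0 ltNge c0.
  have [u [u0 ux] cu] := sup_gt E0 cx.
  by exists u.
move=> [u /= cu ux].
apply: (lt_le_trans cu); apply: ub_le_sup; first exact: radial_bounded.
by split => //; exact: le_lt_trans cu.
Qed.
End sets.

Section univariate.
Context {R : realType}.
Implicit Types (V W : probability R R) (x v : R) (n : nat).

Definition pair_add (p : R * R) : R := p.1 + p.2.

Lemma measurable_pair_add : measurable_fun [set: R * R] pair_add.
Proof. exact: measurable_funD measurable_fst measurable_snd. Qed.

HB.instance Definition _ :=
  isMeasurableFun.Build _ _ _ _ pair_add measurable_pair_add.

Definition convolution V W : probability R R :=
  distribution (V \x W)%E pair_add.

Fixpoint convolution_pow V n : probability R R :=
  if n is m.+1 then convolution V (convolution_pow V m) else \d_(0 : R).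

Definition tail V x : R := fine (V `]x, +oo[%classic).

(* Stated for every n >= 2; the first one already implies the others. *)
Definition subexponential V := forall n, (2 <= n)%N ->
  (fun x => tail (convolution_pow V n) x / tail V x) @ +oo --> (n%:R : R).

Definition positively_decreasing V := exists2 v, 1 < v &
  (limf_esup (fun x => (tail V (v * x) / tail V x)%:E) (+oo%R : set_system R)
     < 1)%E.

(* Subexponential and positively decreasing, with unbounded support. *)
Definition class_A V :=
  [/\ forall x, 0 < tail V x, subexponential V & positively_decreasing V].

End univariate.

Section multivariate_class.
Context {R : realType} {d : nat}.
Variables (A : set 'rV[R]_d) (hA : risk_set A).

Let radial_mixin := isMeasurableFun.Build _ _ _ _ _ (measurable_radial hA).

Definition radial_mfun : {mfun borel_rV R d >-> R} :=
  HB.pack (radial A) radial_mixin.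

Definition radial_law (F : probability (borel_rV R d) R) : probability R R :=
  distribution F radial_mfun.

Definition multivariate_class_A (F : probability (borel_rV R d) R) :=
  class_A (radial_law F).

End multivariate_class.

Section independence.
Context {dO : measure_display} {Omega : measurableType dO} {R : realType}.
Variable P : probability Omega R.

Definition mutually_independent (I : choiceType) (dE : measure_display)
    (E : measurableType dE) (X : I -> {RV P >-> E}) :=
  forall (J : seq I) (B : I -> set E), uniq J ->
    (forall i, measurable (B i)) ->
    P (\bigcap_(i in [set` J]) (X i @^-1` B i))
    = (\prod_(i <- J) P (X i @^-1` B i))%E.

Definition iid (dE : measure_display) (E : measurableType dE)
    (X : nat -> {RV P >-> E}) :=
  mutually_independent X /\
  forall i (B : set E), measurable B -> P (X i @^-1` B) = P (X 0%N @^-1` B).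

Definition independent_systems (G H : set (set Omega)) :=
  forall B C, G B -> H C -> P (B `&` C) = (P B * P C)%E.

Definition sigma_of (I : Type) (D : set I) (dE : measure_display)
    (E : measurableType dE) (X : I -> Omega -> E) : set (set Omega) :=
  <<s [set C | exists i (B : set E),
               [/\ D i, measurable B & C = X i @^-1` B]] >>.

End independence.

Section renewal.
Context {dO : measure_display} {Omega : measurableType dO} {R : realType}.
Variables (P : probability Omega R) (theta : nat -> {RV P >-> R}).
Implicit Types (t : R) (w : Omega) (n : nat).

(* Indices are shifted by one: [theta i] and [X i] are the (i+1)-st inter-arrival
   time and claim, so that [arrival n] is the n-th arrival time, with
   [arrival 0 = 0]. *)
Definition arrival n w : R := \sum_(i < n) theta i w.

Lemma measurable_arrival n : measurable_fun setT (arrival n).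
Proof. by apply: measurable_sum => i; exact: measurable_funPT. Qed.

HB.instance Definition _ n :=
  isMeasurableFun.Build _ _ _ _ (arrival n) (measurable_arrival n).

(* Extended-real valued, since the supremum may be infinite on a null set. *)
Definition renewal_count t w : \bar R :=
  ereal_sup [set n%:R%:E | n in [set n | arrival n w <= t]].

Definition renewal_fun t : \bar R := (\int[P]_w renewal_count t w)%E.

Definition renewal_measure : {measure set R -> \bar R} :=
  mseries (fun i => distribution P (arrival i.+1)) 0.

End renewal.

Section aggregate.
Context {dO : measure_display} {Omega : measurableType dO} {R : realType}.
Context {d : nat}.
Variables (P : probability Omega R) (X : nat -> {RV P >-> borel_rV R d}).
Variable theta : nat -> {RV P >-> R}.

(* [fine] sends an infinite count to 0; this only matters on the null event where
   infinitely many arrivals occur before t. *)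
Definition discounted_claims (r t : R) (w : Omega) : 'rV[R]_d :=
  \sum_(i < Num.truncn (fine (renewal_count theta t w)))
    expR (- r * arrival theta i.+1 w) *: (X i w : 'rV[R]_d).

End aggregate.

Definition uniform_equiv (R : realType) (T : Type) (E : set T)
    (f g : R -> T -> R) :=
  (fun x => ereal_sup [set `|f x t / g x t - 1|%:E | t in E])
    @ (+oo%R : set_system R) --> 0%E.

(* Main.v *)
From HB Require Import structures.
Require Import Defs.
From mathcomp Require Import all_boot all_order all_algebra.
From mathcomp Require Import all_classical all_reals all_analysis.
From mathcomp Require Import measurable_realfun ring lra.

Set Implicit Arguments.
Unset Strict Implicit.
Unset Printing Implicit Defensive.
Import Order.TTheory GRing.Theory Num.Theory.
Import numFieldNormedType.Exports.

Local Open Scope classical_set_scope.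
Local Open Scope ring_scope.

(** The proof replaces the random vectors by real variables.  Let Y_i be the
    radial size of the i-th claim, the supremum of the u such that the claim
    lies in u A.  As A is increasing with convex complement, the radial
    functional is monotone, positively homogeneous and subadditive on
    nonnegative vectors ([dilateP], [radial_sum], [le_radial_sum]).  Hence, with
    the discount factors c_i = exp(-r tau_(i+1)) of the claims arrived by time
    t, the event that the discounted sum lies in x A is contained in
    {x < sum_i c_i Y_i} and contains {x < c_i Y_i for some i}.

    The claim sizes and the arrival times are independent, so both events can be
    studied conditionally on the arrival times ([randomize]): the weights are
    then deterministic.  Since arrivals are more than eps apart, the weights
    satisfy c_i <= rho^i c_0 with rho = exp(-r eps) < 1, uniformly in t.  It
    remains to show that, when x tends to infinity, the probabilities of
    {x < sum_i c_i Y_i} and {x < c_i Y_i for some i} are both equivalent to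
    sum_i P(x < c_i Y_i), uniformly over all such finite weight sequences
    ([weighted_one_big_jump]).  Averaged over the arrival times, that last sum is
    the integral against the renewal measure ([renewal_integral]).

    The lower bound is the Bonferroni inequality, because sum_i P(x < rho^i Y_i)
    is at most a constant times P(x < Y) by positive decrease ([pd_sum]), and so
    tends to 0.  For the upper bound one rescales to c_0 = 1.  Either some term
    exceeds x - h, which costs sum_i P(x < c_i Y_i) up to a factor close to 1
    (long tails for the large weights, positive decrease for the small ones,
    [single_jump]), or the sum exceeds x without any such term.  The latter event
    is negligible ([no_big_jump]): it lies in the event that the majorant
    T = Y_0 + ... + Y_(N-1) + sum_(i >= N) rho^i Y_i exceeds x, and is disjoint
    from the N events that Y_i alone exceeds x while the rest of T is at most h;
    those almost exhaust the probability of {x < T}, which is about N P(x < Y).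
    This last estimate ([total_tail]) rests on subexponentiality for the first N
    terms and on a bound of Kesten type, uniform in the number of terms, for
    the geometric remainder ([kesten_bound]). *)

(** * Real-valued probabilities and independent pairs *)

Section real_probability.
Context {dO : measure_display} {Omega : measurableType dO} {R : realType}.
Variable P : probability Omega R.
Implicit Types (S T : set Omega) (F : nat -> set Omega).

(** Real values turn the estimates below into ordinary real arithmetic; [fine]
    loses nothing on measurable sets, where P is finite. *)
Definition pr S : R := fine (P S).

Lemma prE S : measurable S -> P S = (pr S)%:E.
Proof. by move=> mS; rewrite fineK// fin_num_measure. Qed.

Lemma pr_ge0 S : 0 <= pr S.
Proof. by rewrite fine_ge0. Qed.

Lemma pr_le1 S : measurable S -> pr S <= 1.
Proof. by move=> mS; rewrite -lee_fin -prE// probability_le1. Qed.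

Lemma le_pr S T : measurable S -> measurable T -> S `<=` T -> pr S <= pr T.
Proof. by move=> mS mT ST; rewrite -lee_fin -!prE// le_measure ?inE. Qed.

Lemma pr_setC S : measurable S -> pr (~` S) = 1 - pr S.
Proof.
move=> mS; apply: EFin_inj; rewrite -prE; last exact: measurableC.
by rewrite probability_setC// prE.
Qed.

Lemma prU S T : measurable S -> measurable T -> S `&` T = set0 ->
  pr (S `|` T) = pr S + pr T.
Proof.
move=> mS mT ST; apply: EFin_inj; rewrite EFinD -!prE//; last exact: measurableU.
by rewrite measureU.
Qed.

Lemma prU_le S T : measurable S -> measurable T -> pr (S `|` T) <= pr S + pr T.
Proof.
move=> mS mT; rewrite -lee_fin EFinD -!prE//; last exact: measurableU.
exact: measureU2.
Qed.

Lemma pr_le_sum n S F : measurable S -> (forall i, (i < n)%N -> measurable (F i)) ->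
  (forall w, S w -> exists2 i, (i < n)%N & F i w) ->
  pr S <= \sum_(i < n) pr (F i).
Proof.
elim: n S => [|n IH] S mS mF SF.
  rewrite big_ord0 (_ : S = set0) /pr ?measure0//.
  by apply/seteqP; split => // w /SF[].
have mFn : measurable (F n) by exact: mF.
rewrite big_ord_recr/=.
have mSn : measurable (S `&` ~` F n) by apply: measurableI => //; exact: measurableC.
apply: (@le_trans _ _ (pr ((S `&` ~` F n) `|` F n))).
  apply: le_pr => //; first exact: measurableU.
  by move=> w Sw; have [Fw|nF] := pselect (F n w); [right|left].
apply: (le_trans (prU_le mSn mFn)); rewrite lerD2r; apply: IH => //.
  by move=> i ni; apply: mF; exact: ltnW.
move=> w [/SF[i]]; rewrite ltnS leq_eqVlt => /orP[/eqP -> //|ni] Fi _.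
by exists i.
Qed.

Lemma sum_pr_le n S F : measurable S -> (forall i, (i < n)%N -> measurable (F i)) ->
  (forall i, (i < n)%N -> F i `<=` S) ->
  (forall i j w, (i < j)%N -> (j < n)%N -> F i w -> F j w -> False) ->
  \sum_(i < n) pr (F i) <= pr S.
Proof.
elim: n S => [|n IH] S mS mF FS dF; first by rewrite big_ord0 pr_ge0.
have mFn : measurable (F n) by exact: mF.
have mSn : measurable (S `&` ~` F n) by apply: measurableI => //; exact: measurableC.
rewrite big_ord_recr/= (_ : S = (S `&` ~` F n) `|` F n); last first.
  apply/seteqP; split => w; first by have [Fw|nF] := pselect (F n w); [right|left].
  by move=> [[]//|/FS]; apply.
rewrite prU//; last by rewrite -setIA setICl setI0.
rewrite lerD2r; apply: IH => //.
- by move=> i ni; apply: mF; exact: ltnW.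
- move=> i ni w Fi; split; first by apply: FS Fi; exact: ltnW.
  by move=> Fn; exact: (dF i n w).
- by move=> i j w ij jn; apply: dF => //; exact: ltnW.
Qed.

(** Bonferroni: the i-th event adds its probability to that of the union of
    the previous ones, up to an overlap that pairwise independence bounds by
    the product of its probability with the sum of the previous ones. *)
Lemma sum_sub_sqr_le_pr n S F : measurable S ->
  (forall i, (i < n)%N -> measurable (F i)) ->
  (forall i, (i < n)%N -> F i `<=` S) ->
  (forall i j, (i < j)%N -> (j < n)%N -> pr (F i `&` F j) = pr (F i) * pr (F j)) ->
  let s := \sum_(i < n) pr (F i) in s - s ^+ 2 <= pr S.
Proof.
move=> mS mF FS iF /=.
pose U m := [set w | exists2 i, (i < m)%N & F i w].
have mU m : (m <= n)%N -> measurable (U m).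
  elim: m => [_|m IH mn].
    by rewrite (_ : U 0%N = set0)//; apply/seteqP; split => // w [].
  rewrite (_ : U m.+1 = U m `|` F m).
    by apply: measurableU; [apply: IH; exact: ltnW|exact: mF].
  apply/seteqP; split => w.
    move=> [i]; rewrite ltnS leq_eqVlt => /orP[/eqP -> //|im] Fi; first by right.
    by left; exists i.
  by move=> [[i im Fi]|Fm]; [exists i => //; exact: ltnW|exists m].
suff H m : (m <= n)%N ->
    \sum_(i < m) pr (F i) - (\sum_(i < m) pr (F i)) ^+ 2 <= pr (U m).
  by apply: (le_trans (H n (leqnn _))); apply: le_pr => //;
    [exact: mU|move=> w [i ni]; exact: FS].
elim: m => [_|m IH mn]; first by rewrite !big_ord0 expr0n/= subr0 pr_ge0.
rewrite !big_ord_recr/=; set s := \sum_(i < m) _ in IH *.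
have mUm := mU m (ltnW mn); have mFm := mF m mn.
have mI : measurable (U m `&` F m) by exact: measurableI.
have Ile : pr (U m `&` F m) <= s * pr (F m).
  rewrite mulr_suml.
  rewrite (eq_bigr (fun i : 'I_m => pr (F i `&` F m))); last by move=> i _; rewrite iF.
  apply: (@pr_le_sum m _ (fun i => F i `&` F m)) => //.
    by move=> i im; apply: measurableI => //; apply: mF; exact: ltn_trans mn.
  by move=> w [[i im Fi] Fm]; exists i.
have -> : U m.+1 = U m `|` (F m `&` ~` (U m `&` F m)).
  apply/seteqP; split => w.
    have [Uw|nU] := pselect (U m w); first by left.
    move=> [i]; rewrite ltnS leq_eqVlt => /orP[/eqP -> |im] Fi;
      last by exfalso; apply: nU; exists i.
    by right; split => // -[].
  by move=> [[i im Fi]|[Fm _]]; [exists i => //; exact: ltnW|exists m].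
have mD : measurable (F m `&` ~` (U m `&` F m)).
  by apply: measurableI => //; exact: measurableC.
rewrite prU//; last first.
  by apply/seteqP; split => // w [Uw [Fw]]; apply.
have : pr (F m) = pr (F m `&` ~` (U m `&` F m)) + pr (U m `&` F m).
  rewrite -prU//; last by rewrite -setIA setICl setI0.
  by congr pr; apply/seteqP; split => w;
    [have [?|?] := pselect ((U m `&` F m) w); [right|left]|move=> [[]|[]]].
have p0 := pr_ge0 (F m).
have s0 : 0 <= s by apply: sumr_ge0 => i _; exact: pr_ge0.
have := IH (ltnW mn).
nra.
Qed.

End real_probability.

Section independent_pair.
Context {dO : measure_display} {Omega : measurableType dO} {R : realType}.
Variable P : probability Omega R.
Context {d1 d2} {T1 : measurableType d1} {T2 : measurableType d2}.

Definition independent_pair (U : Omega -> T1) (V : Omega -> T2) :=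
  forall A B, measurable A -> measurable B ->
    P (U @^-1` A `&` V @^-1` B) = (P (U @^-1` A) * P (V @^-1` B))%E.

(** Conditioning on U: the joint law of an independent pair is the product of
    the laws, and the product measure is computed by integrating slices.  The
    maps need not be real-valued; with U and V the identity of Omega, viewed as
    a map into Omega with two coarser sigma-algebras, the right-hand side
    freezes one family of variables while the other stays random. *)
Lemma independent_slices (U : Omega -> T1) (V : Omega -> T2) (E : set (T1 * T2)) :
  measurable_fun setT U -> measurable_fun setT V -> independent_pair U V ->
  measurable E ->
  measurable_fun setT (fun w => P [set w' | E (U w, V w')]) /\
  P [set w | E (U w, V w)] = (\int[P]_w P [set w' | E (U w, V w')])%E.
Proof.
move=> mU mV UV mE.
pose Um : {mfun Omega >-> T1} := HB.pack U (isMeasurableFun.Build _ _ _ _ _ mU).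
pose Vm : {mfun Omega >-> T2} := HB.pack V (isMeasurableFun.Build _ _ _ _ _ mV).
have mUV : measurable_fun setT (fun w => (U w, V w)) by exact/measurable_fun_pairP.
pose W : {mfun Omega >-> (T1 * T2)%type} :=
  HB.pack (fun w => (U w, V w)) (isMeasurableFun.Build _ _ _ _ _ mUV).
have mx := measurable_fun_xsection (distribution P Vm) mE.
have -> : (fun w => P [set w' | E (U w, V w')]) =
    (distribution P Vm \o xsection E) \o U.
  apply/funext => w /=; rewrite /distribution/= /pushforward; congr (P _).
  by apply/seteqP; split => w' /=; rewrite /xsection/= in_setE.
split; first exact: measurableT_comp.
have -> : P [set w | E (U w, V w)] = distribution P W E by [].
rewrite -(@product_measure_unique _ _ _ _ _ (distribution P Um) (distribution P Vm)
  (distribution P W) _ _ mE); last by move=> A B mA mB; exact: UV.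
by rewrite -(ge0_integral_distribution Um mx)// => y; exact: measure_ge0.
Qed.

End independent_pair.

Section independent_real.
Context {dO : measure_display} {Omega : measurableType dO} {R : realType}.
Variable P : probability Omega R.
Implicit Types (U : Omega -> R) (x : R) (A B : set R).

Lemma measurable_gt U x : measurable_fun setT U -> measurable [set w | x < U w].
Proof.
by move=> mU; rewrite -[X in measurable X]setTI; exact: measurable_fun_ltr.
Qed.

Lemma measurable_le U x : measurable_fun setT U -> measurable [set w | U w <= x].
Proof.
by move=> mU; rewrite -[X in measurable X]setTI; exact: measurable_fun_ler.
Qed.

Lemma pr_le_gt U x : measurable_fun setT U ->
  pr P [set w | U w <= x] = 1 - pr P [set w | x < U w].
Proof.
move=> mU; rewrite -pr_setC; last exact: measurable_gt.
by congr pr; apply/seteqP; split => w /=; [rewrite leNgt => /negP|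
  move=> /negP; rewrite -leNgt].
Qed.

Lemma pr_independent U V A B : measurable_fun setT U -> measurable_fun setT V ->
  independent_pair P U V -> measurable A -> measurable B ->
  pr P (U @^-1` A `&` V @^-1` B) = pr P (U @^-1` A) * pr P (V @^-1` B).
Proof.
move=> mU mV iUV mA mB; apply: EFin_inj; rewrite EFinM -!prE; first exact: iUV.
- by rewrite -[X in measurable X]setTI; exact: mV.
- by rewrite -[X in measurable X]setTI; exact: mU.
- by apply: measurableI; rewrite -[X in measurable X]setTI; [exact: mU|exact: mV].
Qed.

End independent_real.

(** * Independence of disjoint groups of variables *)

Section grouping.
Context {dO : measure_display} {Omega : measurableType dO} {R : realType}.
Variable P : probability Omega R.

(** Complements and disjoint unions preserve independence from a fixed event,
    so the events independent of it form a Dynkin system. *)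
Let independent_setC (S C : set Omega) : measurable S -> measurable C ->
  P (S `&` C) = (P S * P C)%E -> P (~` S `&` C) = (P (~` S) * P C)%E.
Proof.
move=> mS mC SC.
have E : P (C `\` S) = (P C - P (C `&` S))%E.
  by apply: measureD => //; rewrite ltey_eq fin_num_measure.
rewrite setIC -setDE E (setIC C) SC probability_setC// muleBl ?mul1e//.
  by rewrite fin_num_measure.
Qed.

Let independent_bigcup (F : (set Omega)^nat) (C : set Omega) :
  (forall n, measurable (F n)) -> trivIset setT F -> measurable C ->
  (forall n, P (F n `&` C) = (P (F n) * P C)%E) ->
  P (\bigcup_n F n `&` C) = (P (\bigcup_n F n) * P C)%E.
Proof.
move=> mF tF mC FC; rewrite setI_bigcupl !measure_bigcup//=; last 2 first.
- by move=> n _; exact: measurableI.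
- exact: trivIset_setIr.
under eq_eseriesr do rewrite FC muleC.
by rewrite (prE _ mC) nneseriesZl// muleC.
Qed.

Lemma dynkin_independent (G H : set (set Omega)) :
  G `<=` measurable -> setI_closed G ->
  H `<=` measurable -> independent_systems P G H ->
  independent_systems P <<s G >> H.
Proof.
move=> mG GI mH GH B C sB HC.
have mC := mH _ HC.
have sG : <<s G >> `<=` measurable.
  by apply: smallest_sub => //; exact: sigma_algebra_measurable.
pose T := g_sigma_algebraType G.
apply: (@dynkin_induction _ T G (fun B => P (B `&` C) = (P B * P C)%E)) => //.
- by rewrite setTI probability_setT mul1e.
- by move=> S GS; exact: GH.
- by move=> S /sG mS; exact: independent_setC.
- by move=> F mF tF; apply: independent_bigcup => // n; exact: sG (mF n).
Qed.

Lemma independent_systems_sym (G H : set (set Omega)) :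
  independent_systems P G H -> independent_systems P H G.
Proof. by move=> GH B C HB GC; rewrite setIC GH// muleC. Qed.

(** Dynkin argument on each side in turn: independence passes from
    intersection-stable families to the sigma-algebras they generate. *)
Lemma independent_sigma (G H : set (set Omega)) :
  G `<=` measurable -> setI_closed G -> H `<=` measurable -> setI_closed H ->
  independent_systems P G H -> independent_systems P <<s G >> <<s H >>.
Proof.
move=> mG GI mH HI GH; apply: dynkin_independent => //.
  by apply: smallest_sub => //; exact: sigma_algebra_measurable.
apply/independent_systems_sym/dynkin_independent => //.
exact: independent_systems_sym.
Qed.

Context {dE : measure_display} {E : measurableType dE} {I : choiceType}.

(** The finite intersections form a family closed under intersection, on which
    mutual independence is a statement about finite products. *)
Definition cylinder (D : set I) (X : I -> Omega -> E) : set (set Omega) :=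
  [set S | exists J (B : I -> set E),
     [/\ uniq J, {in J, forall i, D i}, forall i, measurable (B i) &
         S = \bigcap_(i in [set` J]) (X i @^-1` B i)]].

Variable X : I -> {RV P >-> E}.

Lemma cylinder_measurable D : cylinder D X `<=` measurable.
Proof.
move=> _ [J [B [_ _ mB ->]]]; apply: fin_bigcap_measurable => // i _.
by rewrite -[X in measurable X]setTI; exact: measurable_funPT.
Qed.

Lemma cylinder_setI D : setI_closed (cylinder D X).
Proof.
move=> _ _ [J1 [B1 [u1 D1 m1 ->]]] [J2 [B2 [u2 D2 m2 ->]]].
exists (undup (J1 ++ J2)), (fun i =>
  (if i \in J1 then B1 i else setT) `&` (if i \in J2 then B2 i else setT)).
split; first exact: undup_uniq.
- by move=> i; rewrite mem_undup mem_cat => /orP[/D1|/D2].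
- by move=> i; apply: measurableI; case: ifP.
- apply/seteqP; split => w /=.
    move=> [S1 S2] i /=; rewrite mem_undup => _; split.
      by case: ifPn => // /S1.
    by case: ifPn => // /S2.
  move=> S; split => i /= iJ; have := S i; rewrite /= mem_undup mem_cat iJ ?orbT.
    by move=> /(_ isT)[].
  by move=> /(_ isT)[].
Qed.

Lemma sub_sigma_cylinder D : sigma_of D X `<=` <<s cylinder D X >>.
Proof.
apply: smallest_sub; first exact: smallest_sigma_algebra.
move=> _ [i [B [Di mB ->]]]; apply: sub_sigma_algebra.
exists [:: i], (fun=> B); split => //.
  by move=> j; rewrite inE => /eqP ->.
by rewrite set_cons1 bigcap_set1.
Qed.

Lemma sigma_of_measurable D : sigma_of D X `<=` measurable.
Proof.
apply: smallest_sub; first exact: sigma_algebra_measurable.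
move=> _ [i [B [_ mB ->]]].
by rewrite -[X in measurable X]setTI; exact: measurable_funPT.
Qed.

(** On cylinders over disjoint index sets the product formula for the
    concatenated index sequence factors; [independent_sigma] does the rest. *)
Lemma independent_groups (D1 D2 : set I) : mutually_independent X ->
  D1 `&` D2 = set0 -> independent_systems P (sigma_of D1 X) (sigma_of D2 X).
Proof.
move=> iX D12 B C /sub_sigma_cylinder BD /sub_sigma_cylinder CD.
apply: independent_sigma BD CD => //; try exact: cylinder_measurable;
  try exact: cylinder_setI.
move=> _ _ [J1 [B1 [u1 S1 m1 ->]]] [J2 [B2 [u2 S2 m2 ->]]].
have d12 i : i \in J1 -> i \in J2 -> False.
  by move=> /S1 ? /S2 ?; have : (D1 `&` D2) i by []; rewrite D12.
have u12 : uniq (J1 ++ J2).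
  rewrite cat_uniq u1 u2 andbT /=; apply/hasPn => i iJ2 /=.
  by apply/negP => iJ1; exact: d12 iJ1 iJ2.
pose B' i := if i \in J1 then B1 i else B2 i.
have E1 : \bigcap_(i in [set` J1]) (X i @^-1` B1 i) =
          \bigcap_(i in [set` J1]) (X i @^-1` B' i).
  by apply: eq_bigcapr => i /= iJ; rewrite /B' iJ.
have E2 : \bigcap_(i in [set` J2]) (X i @^-1` B2 i) =
          \bigcap_(i in [set` J2]) (X i @^-1` B' i).
  apply: eq_bigcapr => i /= iJ2; rewrite /B'; case: ifPn => // iJ1.
  by have := d12 _ iJ1 iJ2.
have mB' i : measurable (B' i) by rewrite /B'; case: ifP.
rewrite E1 E2 !(iX _ _ _ mB')// -big_cat/= -(iX _ _ u12 mB').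
congr (P _); rewrite -bigcap_setU; congr (bigcap _ _).
by apply/seteqP; split => i /=; rewrite mem_cat => /orP.
Qed.

End grouping.

Section sigma_functions.
Context {dO : measure_display} {Omega : measurableType dO} {R : realType}.
Context {dE : measure_display} {E : measurableType dE} {I : Type}.

(** Omega with the sigma-algebra generated by the X_i, i in D: a function is
    measurable on it when it depends on these variables only. *)
Definition generated_space (D : set I) (X : I -> Omega -> E) :=
  g_sigma_algebraType [set C | exists i (B : set E),
               [/\ D i, measurable B & C = X i @^-1` B]].

Lemma measurable_generated (D : set I) (X : I -> Omega -> E) i : D i ->
  measurable_fun setT (X i : generated_space D X -> E).
Proof.
move=> Di _ B mB; rewrite setTI; apply: sub_sigma_algebra.
by exists i, B.
Qed.

End sigma_functions.

(** * Tails at infinity and convolutions *)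

Section near_infinity.
Context {R : realType}.
Implicit Types (Q : R -> Prop) (h : R).

Lemma near_pinfty_ge h : \forall x \near +oo%R, h <= x.
Proof. by exists h; split; [exact: num_real|move=> x /ltW]. Qed.

Lemma near_pinftyB Q h : (\forall x \near +oo%R, Q x) ->
  \forall x \near +oo%R, Q (x - h).
Proof.
move=> [M [_ MQ]]; exists (M + h); split; first exact: num_real.
by move=> x xM; apply: MQ; rewrite ltrBrDr.
Qed.

Lemma near_pinftyP Q : (\forall x \near +oo%R, Q x) <->
  exists2 x0, 0 < x0 & forall x, x0 <= x -> Q x.
Proof.
split=> [[M [_ MQ]]|[x0 _ Hx]].
  exists (`|M| + 1) => [|x Mx]; first by rewrite ltr_wpDl.
  by apply: MQ; have := ler_norm M; lra.
by exists x0; split; [exact: num_real|move=> x /ltW; exact: Hx].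
Qed.

Lemma near_pinfty_and Q1 Q2 : (\forall x \near +oo%R, Q1 x) ->
  (\forall x \near +oo%R, Q2 x) -> \forall x \near +oo%R, Q1 x /\ Q2 x.
Proof. exact: filterS2. Qed.

End near_infinity.

Section tails.
Context {R : realType}.
Variable V : probability R R.

Lemma tail_ge0 x : 0 <= tail V x.
Proof. by rewrite fine_ge0. Qed.

Lemma le_tail x y : x <= y -> tail V y <= tail V x.
Proof.
move=> xy; rewrite fine_le ?fin_num_measure// le_measure ?inE//.
by move=> z /=; rewrite !in_itv/= !andbT; exact: le_lt_trans.
Qed.

Lemma tail_small e : 0 < e -> \forall x \near +oo%R, tail V x <= e.
Proof.
move=> e0.
have H : V (\bigcap_n `]n%:R, +oo[%classic) = 0%E.
  rewrite (_ : \bigcap_n _ = set0) ?measure0//; apply/seteqP; split => // x /=.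
  move=> /(_ (Num.truncn x).+1 I)/=; rewrite in_itv/= andbT => /lt_trans.
  by move=> /(_ _ (truncnS_gt x)); rewrite ltxx.
have : V `]n%:R, +oo[%classic @[n --> \oo] --> 0%E.
  rewrite -H; apply: nonincreasing_cvg_mu => //.
  - by rewrite ltey_eq fin_num_measure.
  - exact: bigcapT_measurable.
  - move=> m n mn; apply/subsetPset => x /=; rewrite !in_itv/= !andbT.
    by apply: le_lt_trans; rewrite ler_nat.
move=> /fine_cvgP[_] /cvgrPdist_le /(_ _ e0) [N _ HN].
exists N%:R; split => // x Nx.
have := HN N (leqnn N); rewrite /= sub0r normrN ger0_norm ?fine_ge0//.
by apply: le_trans; apply: le_tail; exact: ltW.
Qed.

End tails.

Section convolution_law.
Context {dO : measure_display} {Omega : measurableType dO} {R : realType}.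
Variable P : probability Omega R.

Lemma convolution_law (V W : probability R R) (U U' : Omega -> R) (B : set R) :
  measurable_fun setT U -> measurable_fun setT U' -> independent_pair P U U' ->
  (forall A, measurable A -> P (U @^-1` A) = V A) ->
  (forall A, measurable A -> P (U' @^-1` A) = W A) ->
  measurable B -> P ((U \+ U') @^-1` B) = convolution V W B.
Proof.
move=> mU mU' iU lU lU' mB.
have mp : measurable_fun setT (fun w => (U w, U' w)) by exact/measurable_fun_pairP.
pose Up : {mfun Omega >-> (R * R)%type} :=
  HB.pack (fun w => (U w, U' w)) (isMeasurableFun.Build _ _ _ _ _ mp).
have mE : measurable (@pair_add R @^-1` B).
  by rewrite -[X in measurable X]setTI; exact: measurable_pair_add.
have -> : convolution V W B = (V \x W)%E (@pair_add R @^-1` B) by [].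
rewrite (@product_measure_unique _ _ _ _ _ V W (distribution P Up))//.
move=> A A' mA mA'; apply: (etrans (iU _ _ mA mA')).
by congr (_ * _)%E; [exact: lU|exact: lU'].
Qed.

(** For fixed U = u the hypothesis on tails applies at y = x - u; integrating
    over the law of U compares the two probabilities. *)
Lemma independent_pair_compare (U Z Y : Omega -> R) (K x : R) (D : set R) :
  measurable_fun setT U -> measurable_fun setT Z -> measurable_fun setT Y ->
  independent_pair P U Z -> independent_pair P U Y -> 0 <= K ->
  (forall y, 0 <= y -> pr P [set w | y < Z w] <= K * pr P [set w | y < Y w]) ->
  measurable D -> (forall u, D u -> u <= x) ->
  pr P [set w | D (U w) /\ x - U w < Z w] <=
  K * pr P [set w | D (U w) /\ x - U w < Y w].
Proof.
move=> mU mZ mY iZ iY K0 KZ mD Dx.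
pose E := [set uz : R * R | D uz.1 /\ x - uz.1 < uz.2].
have mE : measurable E.
  apply: measurableI.
    by rewrite -[X in measurable X]setTI; exact: measurable_fst.
  rewrite -[X in measurable X]setTI; apply: measurable_fun_ltr => //.
  exact: measurable_funB.
have [mEZ EZ] := independent_slices mU mZ iZ mE.
have [mEY EY] := independent_slices mU mY iY mE.
have m2 (T : Omega -> R) : measurable_fun setT T ->
    measurable [set w | E (U w, T w)].
  move=> mT; rewrite -[X in measurable X]setTI.
  have mp : measurable_fun setT (fun w => (U w, T w)) by exact/measurable_fun_pairP.
  exact: mp.
rewrite -lee_fin EFinM -!prE//; [|exact: (m2 _ mY)|exact: (m2 _ mZ)].
rewrite [leLHS]EZ [X in (_ <= _ * X)%E]EY -ge0_integralZl//.
apply: ge0_le_integral => //; first exact: measurable_funeM.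
move=> w _ /=.
have [Dw|nDw] := pselect (D (U w)); last first.
  by rewrite (_ : [set w' | _] = set0) ?measure0 ?mule_ge0//; apply/seteqP;
    split => // w' [].
have mg (T : Omega -> R) : measurable_fun setT T -> measurable [set w' | E (U w, T w')].
  move=> mT; rewrite -[X in measurable X]setTI.
  have mp : measurable_fun setT (fun w' => (U w, T w')).
    by apply/measurable_fun_pairP; split => //; exact: measurable_cst.
  exact: mp.
have e (T : Omega -> R) : [set w' | E (U w, T w')] = [set w' | x - U w < T w'].
  by apply/seteqP; split => w' //= [].
rewrite (prE _ (mg _ mZ)) (prE _ (mg _ mY)) -EFinM lee_fin !e.
by apply: KZ; rewrite subr_ge0; exact: Dx.
Qed.

End convolution_law.

(** * Sums of independent claim sizes *)

Section weighted_sum.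
Context {Omega : Type} {R : realType}.
Variable Y : nat -> Omega -> R.
Implicit Types (c : nat -> R) (a n m : nat) (w : Omega).

(** The offset a makes the remainder of a sum after its first terms a sum of
    the same kind, which the block inductions below need. *)
Definition wsum c a n w : R := \sum_(i < n) c i * Y (a + i)%N w.

Lemma wsum_cat c a m n w :
  wsum c a (m + n) w = wsum c a m w + wsum (fun i => c (m + i)%N) (a + m) n w.
Proof.
rewrite /wsum big_split_ord/=; congr (_ + _).
by apply: eq_bigr => i _; rewrite addnA.
Qed.

Lemma wsumZ (k : R) c a n w : wsum (fun i => k * c i) a n w = k * wsum c a n w.
Proof. by rewrite /wsum mulr_sumr; apply: eq_bigr => i _; rewrite mulrA. Qed.

Lemma wsum1S a n w : wsum (fun=> 1) a n.+1 w = Y a w + wsum (fun=> 1) a.+1 n w.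
Proof.
rewrite /wsum big_ord_recl addn0 mul1r; congr (_ + _).
by apply: eq_bigr => i _; rewrite addSnnS.
Qed.

Hypothesis Y0 : forall i w, 0 <= Y i w.

Lemma wsum_ge0 c a n w : (forall i, (i < n)%N -> 0 <= c i) -> 0 <= wsum c a n w.
Proof. by move=> c0; apply: sumr_ge0 => i _; rewrite mulr_ge0// c0. Qed.

Lemma le_wsum c c' a n w : (forall i, (i < n)%N -> c i <= c' i) ->
  wsum c a n w <= wsum c' a n w.
Proof. by move=> cc; apply: ler_sum => i _; rewrite ler_wpM2r// cc. Qed.

End weighted_sum.

Section independent_sums.
Context {dO : measure_display} {Omega : measurableType dO} {R : realType}.
Variables (P : probability Omega R) (Y : nat -> {RV P >-> R}).
Implicit Types (D : set nat) (U : Omega -> R) (c : nat -> R) (a n m : nat).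

Let Yf : nat -> Omega -> R := Y.

Definition depends_on D U :=
  measurable_fun setT (U : generated_space D Yf -> R).

Lemma depends_on_measurable D U : depends_on D U -> measurable_fun setT U.
Proof.
move=> dU _ B mB; apply: (@sigma_of_measurable _ _ _ P _ _ _ Y D).
exact: (dU measurableT B mB).
Qed.

(** Indices with weight 0 are exempt, so that a sum with one weight set to 0 is
    independent of the corresponding variable. *)
Lemma depends_on_wsum D c a n :
  (forall i, (i < n)%N -> c i != 0 -> D (a + i)%N) -> depends_on D (wsum Yf c a n).
Proof.
move=> Da; rewrite /depends_on /wsum.
pose f i : generated_space D Yf -> R :=
  if (i < n)%N && (c i != 0) then fun w => c i * Yf (a + i)%N w else fun=> 0.
rewrite (_ : (fun w => _) = fun w => \sum_(i < n) f i w); last first.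
  apply/funext => w; apply: eq_bigr => i _; rewrite /f ltn_ord/=.
  by case: eqP => //= ->; rewrite mul0r.
apply: measurable_sum => i; rewrite /f; case: ifP => // /andP[ni ci].
by apply: measurable_funM => //; apply: measurable_generated; exact: Da.
Qed.

Lemma depends_onZ D k U : depends_on D U -> depends_on D (fun w => k * U w).
Proof. by move=> dU; apply: measurable_funM => //. Qed.

Lemma depends_on_rv D i : D i -> depends_on D (Yf i).
Proof. exact: measurable_generated. Qed.

Lemma depends_on_independent D D' U U' : mutually_independent Y ->
  D `&` D' = set0 -> depends_on D U -> depends_on D' U' ->
  independent_pair P U U'.
Proof.
move=> iY DD' dU dU' A B mA mB.
have G (D0 : set nat) (T : Omega -> R) (C : set R) : depends_on D0 T -> measurable C ->
    sigma_of D0 Y (T @^-1` C).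
  by move=> dT mC; have := dT measurableT C mC; rewrite setTI.
by apply: (independent_groups iY DD'); exact: G.
Qed.

End independent_sums.

Section iid_sums.
Context {dO : measure_display} {Omega : measurableType dO} {R : realType}.
Variables (P : probability Omega R) (V : probability R R).
Variable Y : nat -> {RV P >-> R}.
Hypothesis iY : mutually_independent Y.
Hypothesis lawY : forall i (B : set R), measurable B -> P (Y i @^-1` B) = V B.
Hypothesis Y0 : forall i w, 0 <= Y i w.
Implicit Types (c : nat -> R) (a n m N : nat) (x y h : R).

Let Yf : nat -> Omega -> R := Y.
Local Notation W := (wsum Yf (fun=> 1)).
Local Notation tl := (tail V).

Lemma measurable_wsum c a n : measurable_fun setT (wsum Yf c a n).
Proof.
by apply: (@depends_on_measurable _ _ _ P Y setT); exact: depends_on_wsum.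
Qed.

Let mY i : measurable_fun setT (Yf i) := measurable_funPT (Y i).

Lemma pr_tail i x : pr P [set w | x < Y i w] = tl x.
Proof.
rewrite /tail -(lawY i)//; congr (fine (P _)).
by apply/seteqP; split => w /=; rewrite in_itv/= andbT.
Qed.

Lemma law_sum a n (B : set R) : measurable B ->
  P (W a n @^-1` B) = convolution_pow V n B.
Proof.
elim: n a B => [|n IH] a B mB.
  rewrite /= diracE (_ : W a 0 = cst 0); last by apply/funext => w; rewrite /wsum big_ord0.
  rewrite preimage_cst; case: ifPn => _; first by rewrite probability_setT.
  by rewrite measure0.
rewrite (_ : W a n.+1 = (Yf a : Omega -> R) \+ W a.+1 n); last first.
  by apply/funext => w; rewrite wsum1S.
apply: (@convolution_law _ _ _ P V (convolution_pow V n)) => //.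
- exact: measurable_wsum.
- apply: (depends_on_independent iY (D := [set a]) (D' := [set i | (a < i)%N])).
  + by apply/seteqP; split => // i [/= ->]; rewrite ltnn.
  + exact: depends_on_rv.
  + by apply: depends_on_wsum => i _ _ /=; rewrite addSn ltnS leq_addr.
- exact: lawY.
- by move=> A mA; exact: IH.
Qed.

Lemma pr_sum_gt a n x : pr P [set w | x < W a n w] = tail (convolution_pow V n) x.
Proof.
rewrite /tail -(law_sum a)//; congr (fine (P _)).
by apply/seteqP; split => w /=; rewrite in_itv/= andbT.
Qed.

Hypothesis V_gt0 : forall x, 0 < tl x.
Hypothesis V_subexp : subexponential V.

(** Subexponentiality constrains the n-fold convolutions for n >= 2; for n = 1 the
    two sides are equal. *)
Lemma sum_tail n e : (0 < n)%N -> 0 < e ->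
  \forall x \near +oo, forall a,
    (n%:R - e) * tl x <= pr P [set w | x < W a n w] <= (n%:R + e) * tl x.
Proof.
case: n => [//|[_ e0|n _ e0]].
  near=> x => a.
  rewrite (_ : [set w | _] = [set w | x < Y a w]); last first.
    by apply/seteqP; split => w /=; rewrite /wsum big_ord1 addn0 mul1r.
  by rewrite pr_tail; have := V_gt0 x; nra.
have /cvgrPdist_le /(_ e e0) := V_subexp (isT : (2 <= n.+2)%N).
apply: filterS => x H a; rewrite pr_sum_gt.
have t0 := V_gt0 x.
move: H; set A := tail _ x; rewrite ler_norml => /andP[H1 H2].
have -> : A = A / tl x * tl x by rewrite divfK ?gt_eqF.
by rewrite !ler_pM2r//; apply/andP; split; lra.
Unshelve. all: by end_near. Qed.

(** Subexponential tails are long: {x < Y_0}, {Y_0 <= h, x < Y_1} and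
    {h < Y_0 <= x, x - h < Y_1} are disjoint and contained in {x < Y_0 + Y_1}, whose
    probability is about 2 tl x.  The first two already account for
    (2 - tl h) tl x, so the third, of probability (tl h - tl x) tl (x - h), is at
    most about tl h * tl x. *)
Lemma long_tailed h d : 0 < h -> 0 < d ->
  \forall x \near +oo, tl (x - h) <= (1 + d) * tl x.
Proof.
move=> h0 d0.
(* chosen so that (1 + k) / (1 - k) = 1 + d *)
pose k := d / (2 + d).
have k0 : 0 < k by apply: divr_gt0 => //; lra.
have kd : (1 + k) = (1 + d) * (1 - k) by rewrite /k; field; lra.
have k1 : k < 1 by rewrite /k ltr_pdivrMr; lra.
pose e := k * tl h.
have e0 : 0 < e by rewrite mulr_gt0.
have S2 := @sum_tail 2 e isT e0; have Ve := tail_small V e0.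
have xh := near_pinfty_ge h.
move: S2 Ve xh; apply: filterS3 => x S2 Ve xh.
have m1 y i : measurable [set w | y < Y i w] by exact: measurable_gt (mY i).
have m1' y i : measurable [set w | Y i w <= y] by exact: measurable_le (mY i).
have I01 : independent_pair P (Y 0%N) (Y 1%N).
  apply: (depends_on_independent iY (D := [set 0%N]) (D' := [set 1%N])).
  - by apply/seteqP; split => // i [/= ->].
  - exact: depends_on_rv.
  - exact: depends_on_rv.
have IE := pr_independent (mY 0%N) (mY 1%N) I01.
pose F i : set Omega := match i with
  | 0%N => [set w | x < Y 0%N w]
  | 1%N => [set w | Y 0%N w <= h] `&` [set w | x < Y 1%N w]
  | _ => [set w | h < Y 0%N w] `&` [set w | Y 0%N w <= x] `&` [set w | x - h < Y 1%N w]
  end.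
have mF i : measurable (F i).
  by case: i => [|[|i]] /=; do ?apply: measurableI => //.
have P1 : pr P (F 1%N) = (1 - tl h) * tl x.
  rewrite /= (_ : [set w | Y 0%N w <= h] = Y 0%N @^-1` `]-oo, h]%classic); last first.
    by apply/seteqP; split => w /=; rewrite in_itv.
  rewrite (_ : [set w | x < Y 1%N w] = Y 1%N @^-1` `]x, +oo[%classic); last first.
    by apply/seteqP; split => w /=; rewrite in_itv/= andbT.
  rewrite IE//; congr (_ * _); last by rewrite /pr lawY.
  rewrite -(pr_tail 0%N) -(pr_le_gt _ _ (mY 0%N)); congr (pr P _).
have P2 : pr P (F 2%N) = (tl h - tl x) * tl (x - h).
  rewrite /= (_ : _ `&` [set w | Y 0%N w <= x] = Y 0%N @^-1` `]h, x]%classic); last first.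
    by apply/seteqP; split => w /=; rewrite in_itv/= => /andP.
  rewrite (_ : [set w | x - h < Y 1%N w] = Y 1%N @^-1` `]x - h, +oo[%classic); last first.
    by apply/seteqP; split => w /=; rewrite in_itv/= andbT.
  rewrite IE//; congr (_ * _); last by rewrite /pr lawY.
  rewrite -!(pr_tail 0%N); apply/eqP; rewrite eq_sym subr_eq -prU//.
  - apply/eqP; congr (pr P _).
    apply/seteqP; split => w /=; rewrite in_itv/=.
      by move=> hY; rewrite hY/=; case: leP; [left|right].
    by move=> [/andP[]//|]; exact: le_lt_trans.
  - by rewrite -[X in measurable X]setTI; exact: mY.
  - by apply/seteqP; split => // w /=; rewrite in_itv/= => -[/andP[_]]; case: ltP.
have S3 : \sum_(i < 3) pr P (F i) = pr P (F 0%N) + pr P (F 1%N) + pr P (F 2%N).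
  by rewrite !big_ord_recr big_ord0 /= add0r.
have : \sum_(i < 3) pr P (F i) <= pr P [set w | x < W 0%N 2 w].
  have W2 w : W 0%N 2 w = Y 0%N w + Y 1%N w.
    by rewrite /wsum !big_ord_recr big_ord0/= add0r !mul1r.
  apply: sum_pr_le => //; first exact/measurable_gt/measurable_wsum.
    move=> [|[|[|//]]] _ w /=; rewrite W2; have := Y0 0%N w; have := Y0 1%N w.
    - by move=> ? ? ?; lra.
    - by move=> ? ? [_ ?]; lra.
    - by move=> ? ? [[? ?] ?]; lra.
  by move=> [|[|[|i]]] [|[|[|j]]] w //= _ _;
    [move=> ? [? ?]|move=> ? [[? ?] ?]|move=> [? ?] [[? ?] ?]]; lra.
rewrite S3 P1 P2 pr_tail; case/andP: (S2 0%N) => _ {}S2.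
move=> /le_trans/(_ S2) {S2 S3 P1 P2 F mF IE I01 m1'}.
have t0 := V_gt0 x; have th0 := V_gt0 h.
rewrite /e in Ve *; set A := tl x in Ve t0 *; set B := tl h in Ve th0 *.
set C := tl (x - h) => H.
have BA : (1 - k) * B <= B - A by lra.
have H1 : (1 - k) * B * C <= (1 + k) * B * A.
  apply: (@le_trans _ _ ((B - A) * C)); first by rewrite ler_wpM2r ?tail_ge0.
  lra.
have H2 : (1 - k) * C <= (1 + k) * A.
  by rewrite -(ler_pM2l th0); lra.
rewrite kd in H2.
rewrite -(@ler_pM2l _ (1 - k)); last by lra.
lra.
Qed.

End iid_sums.

(** * Positively decreasing tails *)

Section positive_decrease.
Context {R : realType}.
Variable V : probability R R.
Hypothesis V_gt0 : forall x, 0 < tail V x.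
Hypothesis V_pd : positively_decreasing V.
Local Notation tl := (tail V).

Let exp_small (q e : R) : 0 <= q < 1 -> 0 < e -> exists2 k, (0 < k)%N & q ^+ k <= e.
Proof.
move=> /andP[q0 q1] e0.
have /cvg_expr : `|q| < 1 by rewrite ger0_norm.
move=> /cvgrPdist_le /(_ _ e0) [N _ HN].
exists N.+1 => //; have := HN N.+1 (leqnSn N).
by rewrite /= sub0r normrN ger0_norm// exprn_ge0.
Qed.

Let pd_ratio : exists v q M, [/\ 1 < v, 0 <= q < 1, 0 < M &
  forall x, M <= x -> tl (v * x) <= q * tl x].
Proof.
case: V_pd => v v1; rewrite limf_esupE => /ereal_inf_lt[_ [B nB <-] B1].
have [q q01 Bq] : exists2 q : R, 0 <= q < 1 &
    (ereal_sup ((fun x => (tl (v * x) / tl x)%:E) @` B) <= q%:E)%E.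
  move: B1; case: ereal_sup => [s|//|] s1; last by exists 0; rewrite ?lexx ?ltr01 ?leNye.
  exists (Num.max s 0); last by rewrite lee_fin le_max lexx.
  by rewrite le_max lexx orbT gt_max ltr01 -lte_fin s1.
have /near_pinftyP[M M0 MB] := nB.
exists v, q, M; split => // x Mx.
rewrite -ler_pdivrMr// -lee_fin; apply: le_trans Bq; apply: ereal_sup_ubound.
by exists x => //; exact: MB.
Qed.

(** Iterating tl (v x) <= q tl x with q < 1 makes the ratio arbitrarily small at
    the price of a larger factor v^k. *)
Lemma pd_small d : 0 < d -> exists2 u, 1 <= u &
  \forall x \near +oo, forall y, u * x <= y -> tl y <= d * tl x.
Proof.
move=> d0; have [v [q [M [v1 q01 M0 Mq]]]] := pd_ratio.
have [k _ kd] := exp_small q01 d0.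
have iter j x : M <= x -> tl (v ^+ j * x) <= q ^+ j * tl x.
  move=> Mx; elim: j => [|j IH]; first by rewrite !expr0 !mul1r.
  rewrite !exprS -!mulrA; apply: (@le_trans _ _ (q * tl (v ^+ j * x))).
    apply: Mq; apply: (le_trans Mx); rewrite ler_peMl//; first by lra.
    by apply: exprn_ege1; lra.
  by rewrite ler_wpM2l//; case/andP: q01.
exists (v ^+ k); first by apply: exprn_ege1; lra.
apply/near_pinftyP; exists M => // x Mx y /(le_tail V)/le_trans; apply.
by apply: (le_trans (iter k x Mx)); rewrite ler_wpM2r// tail_ge0.
Qed.

Variable rho : R.
Hypothesis rho01 : 0 < rho < 1.

Lemma pd_scale k d : 0 < k -> 0 < d -> exists2 m, (0 < m)%N &
  \forall x \near +oo, forall e, 0 < e -> e <= rho ^+ m -> tl (x / (k * e)) <= d * tl x.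
Proof.
move=> k0 d0; have [u u1 Hu] := pd_small d0.
have q0 : 0 < (k * u)^-1 by rewrite invr_gt0 mulr_gt0//; lra.
have rho01' : 0 <= rho < 1 by case/andP: rho01 => /ltW -> ->.
have [m m0 Hm] := exp_small rho01' q0.
exists m => //; move: Hu (near_pinfty_ge (0 : R)); apply: filterS2 => x Hx x0 e e0 em.
apply: Hx; rewrite ler_pdivlMr; last by rewrite mulr_gt0.
rewrite mulrAC -[leRHS]mul1r ler_wpM2r//.
have := le_trans em Hm; rewrite -(@ler_pM2r _ (k * u)); last by rewrite mulr_gt0//; lra.
by rewrite mulVf ?gt_eqF ?mulr_gt0//; lra.
Qed.

(** Take m with tl (x / rho^m) <= tl x / 2.  The first m terms are at most m tl x,
    and by induction the remaining ones are at most 2 m tl (x / rho^m) <= m tl x. *)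
Lemma pd_sum : exists2 C, 0 < C & \forall x \near +oo,
  forall n, \sum_(i < n) tl (x / rho ^+ i) <= C * tl x.
Proof.
have /andP[r0 r1] := rho01.
have [m m0 Hm] := @pd_scale 1 2^-1 ltr01 ltac:(lra).
have m0' : 0 < m%:R :> R by rewrite ltr0n.
exists (2 * m%:R); first by lra.
have /near_pinftyP[M M0 HM] := Hm.
apply/near_pinftyP; exists M => // x Mx n.
have le1 i : 0 < rho ^+ i <= 1 by rewrite exprn_gt0//= exprn_ile1 ?(ltW r0) ?(ltW r1).
have lex i y : 0 < y -> y <= y / rho ^+ i.
  by move=> y0; case/andP: (le1 i) => a b; rewrite ler_pdivlMr// ler_piMr// ltW.
have blocks k y : M <= y -> \sum_(i < k * m) tl (y / rho ^+ i) <= 2 * m%:R * tl y.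
  elim: k y => [|k IH] y My.
    by rewrite mul0n big_ord0 mulr_ge0// ?tail_ge0//; lra.
  rewrite mulSn big_split_ord/=.
  have y0 : 0 < y by exact: lt_le_trans My.
  apply: (@le_trans _ _ (m%:R * tl y + 2 * m%:R * tl (y / rho ^+ m))).
    apply: lerD.
      rewrite mulr_natl -[X in _ *+ X](card_ord m) -sumr_const.
      by apply: ler_sum => i _; apply: le_tail; exact: lex.
    under eq_bigr do rewrite exprD invfM mulrA.
    by apply: IH; apply: (le_trans My); exact: lex.
  have := HM y My (rho ^+ m); rewrite mul1r => /(_ _ (lexx _)).
  by case/andP: (le1 m) => a _ /(_ a); nra.
apply: le_trans (blocks n x Mx).
have -> : (n * m = n + (n * m - n))%N by rewrite subnKC// leq_pmulr.
rewrite big_split_ord/= lerDl; apply: sumr_ge0 => i _; exact: tail_ge0.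
Qed.

Lemma pd_sum_tail d : 0 < d -> exists J, \forall x \near +oo,
  forall n, \sum_(i < n) tl (x / (2 * rho ^+ (J + i))) <= d * tl x.
Proof.
move=> d0; have /andP[r0 r1] := rho01.
have [C C0 /near_pinftyP[M M0 HC]] := pd_sum.
have [m m0 Hm] := @pd_scale 2 (d / C) ltac:(lra) (divr_gt0 d0 C0).
have [j j0 Hj] := @exp_small rho 2^-1 ltac:(lra) ltac:(lra).
exists (m + j)%N; move: Hm (near_pinfty_ge M); apply: filterS2 => x Hx Mx n.
have e0 : 0 < rho ^+ (m + j) by rewrite exprn_gt0.
have jm : rho ^+ (m + j) <= rho ^+ m.
  by rewrite exprD ler_piMr ?exprn_ge0 ?exprn_ile1//; lra.
have jj : rho ^+ (m + j) <= 2^-1.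
  by apply: le_trans Hj; rewrite exprD ler_piMl ?exprn_ge0 ?exprn_ile1//; lra.
under eq_bigr do rewrite exprD mulrA invfM mulrA.
apply: (le_trans (HC _ _ _)).
  apply: (le_trans Mx); rewrite ler_pdivlMr; last by lra.
  by rewrite ler_piMr; lra.
have := Hx _ e0 jm; rewrite -(ler_pM2l C0) mulrA mulrCA divff ?gt_eqF// mulr1.
by [].
Qed.

End positive_decrease.

(** * One big jump for discounted sums *)

Section one_big_jump.
Context {dO : measure_display} {Omega : measurableType dO} {R : realType}.
Variables (P : probability Omega R) (V : probability R R).
Variable Y : nat -> {RV P >-> R}.
Hypothesis iY : mutually_independent Y.
Hypothesis lawY : forall i (B : set R), measurable B -> P (Y i @^-1` B) = V B.
Hypothesis Y0 : forall i w, 0 <= Y i w.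
Hypothesis V_gt0 : forall x, 0 < tail V x.
Hypothesis V_subexp : subexponential V.
Implicit Types (c : nat -> R) (a n m N : nat) (x y h : R).

Let Yf : nat -> Omega -> R := Y.
Local Notation W := (wsum Yf (fun=> 1)).
Local Notation tl := (tail V).

Let mY i : measurable_fun setT (Yf i) := measurable_funPT (Y i).
Let mW c a n : measurable_fun setT (wsum Yf c a n) := @measurable_wsum _ _ _ P Y c a n.

Lemma sum_tail_small N e : (0 < N)%N -> 0 < e ->
  \forall x \near +oo, forall a, pr P [set w | x < W a N w] <= e.
Proof.
move=> N0 e0; have N1 : 0 < N%:R + 1 :> R by rewrite ltr_wpDl.
have := tail_small V (divr_gt0 e0 N1).
have := sum_tail iY lawY V_gt0 V_subexp N0 ltr01.
apply: filterS2 => x H t a; have /andP[_ /le_trans] := H a; apply.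
by rewrite mulrC -ler_pdivlMr.
Qed.

(** If W + e Z exceeds x then W > x - h, or e Z > x - h, or else h < W <= x - h.  In
    the last case Z may be replaced, at the cost of a factor K, by a fresh copy Y'
    of the claim size, and W + Y' is again a sum of claim sizes: it exceeds x
    mostly through W > x or Y' > x, so little probability is left for the
    middle range of W.  The bound is uniform in Z, K and e. *)
Lemma block_tail N d : (0 < N)%N -> 0 < d -> \forall x \near +oo,
  forall a (Z : Omega -> R) K e,
    depends_on Y [set i | (a + N <= i)%N] Z -> (forall w, 0 <= Z w) -> 0 <= K ->
    (forall y, 0 <= y -> pr P [set w | y < Z w] <= K * tl y) ->
    0 < e <= 1 ->
  pr P [set w | x < W a N w + e * Z w] <=
    (N%:R + d + K * d) * tl x + K * tl (x / (2 * e)).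
Proof.
move=> N0 d0.
pose e := d / 3; have e0 : 0 < e by rewrite /e; lra.
have [h h0 Hh] := (near_pinftyP _).1 (sum_tail_small N0 e0).
have {}Hh := Hh h (lexx _).
have N1 : 1 <= N%:R :> R by rewrite ler1n.
(* chosen so that (N + e) (1 + k) = N + 2 e; together with e = d / 3 this leaves
   room for the constants N + d and K d of the conclusion *)
pose k := e / (N%:R + e).
have k0 : 0 < k by apply: divr_gt0; lra.
have kE : (N%:R + e) * (1 + k) = N%:R + 2 * e.
  by rewrite mulrDr mulr1 /k mulrC divfK ?gt_eqF; lra.
have S1 := sum_tail iY lawY V_gt0 V_subexp N0 e0.
have S2 := sum_tail iY lawY V_gt0 V_subexp (ltn0Sn N) e0.
have L := long_tailed iY lawY Y0 V_gt0 V_subexp h0 k0.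
have S1h := near_pinftyB h S1.
have x2h := near_pinfty_ge (2 * h).
move: (near_pinfty_and S1 S1h) S2 (near_pinfty_and L x2h).
apply: filterS3 => x [{}S1 {}S1h] {}S2 [{}L {}x2h].
move=> a Z K eta dZ Z0 K0 KZ /andP[eta0 eta1].
have mZ : measurable_fun setT Z := depends_on_measurable dZ.
have mZe : measurable_fun setT (fun w => eta * Z w) by exact: measurable_funM.
have W0 w : 0 <= W a N w by exact: wsum_ge0.
have t0 := V_gt0 x.
(* the three ways of exceeding x; the half-open interval of G 2 is the
   middle range of W *)
pose G i : set Omega := match i with
  | 0%N => [set w | x - h < W a N w]
  | 1%N => [set w | x - h < eta * Z w]
  | _ => [set w | `]h, x - h]%classic (W a N w) /\ x - W a N w < Z w] end.
have mWZ (T : Omega -> R) : measurable_fun setT T ->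
    measurable [set w | `]h, x - h]%classic (W a N w) /\ x - W a N w < T w].
  move=> mT; apply: measurableI.
    by rewrite -[X in measurable X]setTI; exact: mW.
  rewrite -[X in measurable X]setTI; apply: measurable_fun_ltr => //.
  exact: measurable_funB.
have mG i : measurable (G i).
  by case: i => [|[|i]] /=; [exact: measurable_gt|exact: measurable_gt|exact: mWZ].
have : pr P [set w | x < W a N w + eta * Z w] <= \sum_(i < 3) pr P (G i).
  apply: pr_le_sum => [|i _|w /= xw]; [|exact: mG|].
    by apply: measurable_gt; exact: measurable_funD.
  have [g0|g0] := ltP (x - h) (W a N w); first by exists 0%N.
  have [g1|g1] := ltP (x - h) (eta * Z w); first by exists 1%N.
  exists 2%N => //=; rewrite in_itv/=; split; first by apply/andP; split; lra.
  have : eta * Z w <= Z w by rewrite ler_piMl.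
  by lra.
have G0 : pr P (G 0%N) <= (N%:R + d) * tl x.
  have /andP[_ /le_trans->//] := S1h a.
  apply: (@le_trans _ _ ((N%:R + e) * ((1 + k) * tl x))).
    by rewrite ler_wpM2l//; lra.
  by rewrite mulrA kE ler_wpM2r ?ltW//; rewrite /e; lra.
have G1 : pr P (G 1%N) <= K * tl (x / (2 * eta)).
  rewrite /= (_ : [set w | _] = [set w | (x - h) / eta < Z w]); last first.
    by apply/seteqP; split => w /=; rewrite ltr_pdivrMr// mulrC.
  apply: (le_trans (KZ _ _)); first by apply: divr_ge0; lra.
  rewrite ler_wpM2l// le_tail//.
  by rewrite invfM mulrA ler_pM2r ?invr_gt0//; lra.
have G2 : pr P (G 2%N) <= K * (d * tl x).
  set Y' := Yf (a + N)%N.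
  have iWY : independent_pair P (W a N) Y'.
    apply: (depends_on_independent iY (D := [set i | (i < a + N)%N]) (D' := [set (a + N)%N])).
    - by apply/seteqP; split => // i [/= ia ib]; move: ia; rewrite ib ltnn.
    - by apply: depends_on_wsum => i iN _ /=; rewrite ltn_add2l.
    - exact: depends_on_rv.
  have iWZ : independent_pair P (W a N) Z.
    apply: (depends_on_independent iY (D := [set i | (i < a + N)%N])
        (D' := [set i | (a + N <= i)%N])) => //.
    - by apply/seteqP; split => // i [/=]; rewrite ltnNge => /negP.
    - by apply: depends_on_wsum => i iN _ /=; rewrite ltn_add2l.
  have KZ' y : 0 <= y -> pr P [set w | y < Z w] <= K * pr P [set w | y < Y' w].
    by move=> y0; rewrite (pr_tail lawY); exact: KZ.
  have := @independent_pair_compare _ _ _ P _ _ _ _ x `]h, x - h]%classic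
    (mW _ _ _) mZ (mY _) iWZ iWY K0 KZ' (measurable_itv _).
  move=> /(_ _)/le_trans; apply.
    by move=> u /=; rewrite in_itv/= => /andP[_]; lra.
  rewrite ler_wpM2l//.
  (* disjoint parts of {x < W + Y'} of probability close to tl x and N tl x,
     and the middle range, which gets what remains of (N + 1) tl x *)
  pose F i : set Omega := match i with
    | 0%N => [set w | W a N w <= h] `&` [set w | x < Y' w]
    | 1%N => [set w | x < W a N w]
    | _ => [set w | `]h, x - h]%classic (W a N w) /\ x - W a N w < Y' w] end.
  have mF i : measurable (F i).
    case: i => [|[|i]] /=; [|exact: measurable_gt|exact: mWZ].
    by apply: measurableI; [exact: measurable_le|exact: measurable_gt (mY _)].
  have Y'0 w : 0 <= Y' w by exact: Y0.
  have WS w : W a N.+1 w = W a N w + Y' w by rewrite /wsum big_ord_recr/= mul1r.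
  have : \sum_(i < 3) pr P (F i) <= pr P [set w | x < W a N.+1 w].
    apply: sum_pr_le => [|i _||]; [exact: measurable_gt|exact: mF| |].
      move=> [|[|[|//]]] _ w /=; rewrite WS; have := Y'0 w; have := W0 w.
      - by move=> ? ? [_ ?]; lra.
      - by move=> ? ? ?; lra.
      - by move=> ? ? [_ ?]; lra.
    move=> [|[|[|i]]] [|[|[|j]]] w //= _ _; rewrite ?in_itv/=.
    - by move=> [? _] ?; lra.
    - by move=> [? _] [/andP[? ?] _]; lra.
    - by move=> ? [/andP[? ?] _]; lra.
  have F0 : pr P (F 0%N) = (1 - pr P [set w | h < W a N w]) * tl x.
    rewrite -(pr_tail lawY (a + N)%N) -pr_le_gt//.
    have := pr_independent (mW _ _ _) (mY _) iWY (measurable_itv `]-oo, h])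
      (measurable_itv `]x, +oo[).
    have -> : W a N @^-1` `]-oo, h]%classic = [set w | W a N w <= h].
      by apply/seteqP; split => w /=; rewrite in_itv.
    have -> // : Y' @^-1` `]x, +oo[%classic = [set w | x < Y' w].
    by apply/seteqP; split => w /=; rewrite in_itv/= andbT.
  have := S1 a => /andP[F1 _]; have := S2 a => /andP[_ F2].
  rewrite !big_ord_recr big_ord0 /= add0r => /le_trans/(_ F2).
  rewrite -/(F 0%N) F0 -natr1.
  have := Hh a; rewrite /e in F1 F2 *.
  by set p := pr P [set w | h < W a N w]; nra.
rewrite !big_ord_recr big_ord0 /= add0r => /le_trans; apply.
rewrite -/(G 0%N) -/(G 1%N) -/(G 2%N); lra.
Qed.

Hypothesis V_pd : positively_decreasing V.
Variable rho : R.
Hypothesis rho01 : 0 < rho < 1.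
Local Notation Z := (wsum Yf (fun i => rho ^+ i)).

Let rho_ge0 i : 0 <= rho ^+ i.
Proof. by case/andP: rho01 => /ltW r0 _; exact: exprn_ge0. Qed.

Let rho_le1 i : rho ^+ i <= 1.
Proof. by case/andP: rho01 => /ltW r0 /ltW r1; exact: exprn_ile1. Qed.

Let rho_gt0 i : 0 < rho ^+ i.
Proof. by case/andP: rho01 => r0 _; exact: exprn_gt0. Qed.

Let Z_ge0 a n w : 0 <= Z a n w.
Proof. exact: wsum_ge0. Qed.

Let depends_Z a b n : (b <= a)%N -> depends_on Y [set i | (b <= i)%N] (Z a n).
Proof.
move=> ba; apply: depends_on_wsum => i _ _ /=.
by rewrite (leq_trans ba)// leq_addr.
Qed.

(** Induction on the number of blocks of length m.  Bounding the first block by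
    the plain sum W, [block_tail] turns the constant K for the remaining blocks
    into m + 1/4 + K/4 + K/4, which is at most K when K >= 2 (m + 1). *)
Lemma kesten_bound : exists2 K, 0 < K &
  forall a n y, 0 <= y -> pr P [set w | y < Z a n w] <= K * tl y.
Proof.
have [m m0 Hm] := pd_scale V_gt0 V_pd rho01 (ltr0n _ 2) (ltac:(lra) : 0 < 4^-1 :> R).
have Hb := @block_tail m 4^-1 m0 ltac:(lra).
have [x0 x00 H] := (near_pinftyP _).1 (near_pinfty_and Hm Hb).
(* the second summand makes the bound trivial below the threshold x0 *)
pose K := 2 * (m%:R + 1) + (tl x0)^-1.
have V0 : 0 < (tl x0)^-1 by rewrite invr_gt0.
have m0' : 0 <= m%:R :> R by [].
have K0 : 0 < K by rewrite /K; lra.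
exists K => //.
have blocks k : forall a y, 0 <= y -> pr P [set w | y < Z a (k * m) w] <= K * tl y.
  elim: k => [|k IH] a y y0.
    rewrite (_ : [set w | _] = set0); last first.
      by apply/seteqP; split => // w /=; rewrite /wsum big_ord0 ltNge y0.
    by rewrite /pr measure0 mulr_ge0// ?tail_ge0// ltW.
  have [yx|xy] := leP y x0.
    apply: (@le_trans _ _ 1); first by apply: pr_le1; exact/measurable_gt/mW.
    apply: (@le_trans _ _ ((tl x0)^-1 * tl x0)); first by rewrite mulVf ?gt_eqF.
    apply: ler_pM; rewrite ?tail_ge0 ?(ltW V0) ?le_tail//.
    by rewrite /K; lra.
  have [Hm' Hb'] := H y (ltW xy).
  apply: (@le_trans _ _ (pr P [set w | y < W a m w + rho ^+ m * Z (a + m) (k * m) w])).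
    apply: le_pr => [||w /=]; [exact/measurable_gt/mW| |].
      apply: measurable_gt; apply: measurable_funD; first exact: mW.
      by apply: measurable_funM => //; exact: mW.
    rewrite mulSn wsum_cat => /lt_le_trans; apply; apply: lerD.
      by apply: le_wsum => // i _.
    by rewrite -wsumZ; apply: le_wsum => // i _; rewrite exprD.
  apply: (le_trans (Hb' _ _ K _ (depends_Z _ (leqnn _)) _ (ltW K0) (IH _) _)) => //.
    by rewrite rho_gt0 rho_le1.
  have := Hm' _ (rho_gt0 m) (lexx _); have := V_gt0 y.
  rewrite /K in K0 *; set v := (tl x0)^-1 in V0 K0 *; nra.
move=> a n y y0; apply: le_trans (blocks n a y y0).
apply: le_pr => [||w /= /lt_le_trans]; [exact/measurable_gt/mW..|apply].
have -> : (n * m = n + (n * m - n))%N by rewrite subnKC// leq_pmulr.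
by rewrite wsum_cat lerDl; apply: wsum_ge0 => // i _.
Qed.

(** The geometric remainder carries the factor rho^N, so its Kesten bound is
    taken at x / (2 rho^N), where positive decrease makes it negligible. *)
Lemma total_tail d : 0 < d -> exists2 N, (0 < N)%N & \forall x \near +oo,
  forall n, pr P [set w | x < W 0%N N w + rho ^+ N * Z N n w] <= (N%:R + d) * tl x.
Proof.
move=> d0; have [K K0 HK] := kesten_bound.
have dK0 : 0 < d / (2 * K) by rewrite divr_gt0// mulr_gt0.
have [N N0 HN] := pd_scale V_gt0 V_pd rho01 (ltr0n _ 2) dK0.
exists N => //; pose d1 := d / (2 * (1 + K)).
have d10 : 0 < d1 by apply: divr_gt0 => //; lra.
have d1E : d1 + K * d1 = d / 2 by rewrite /d1; field; lra.
move: HN (block_tail N0 d10); apply: filterS2 => x HN Hb n.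
apply: (le_trans (Hb 0%N _ K _ (depends_Z _ _) _ (ltW K0) (HK _ _) _)) => //.
  by rewrite rho_gt0 rho_le1.
have := HN _ (rho_gt0 N) (lexx _); rewrite -(ler_pM2l K0).
have -> : K * (d / (2 * K) * tl x) = d / 2 * tl x by field; lra.
rewrite -addrA d1E.
have -> : (N%:R + d) * tl x = (N%:R + d / 2) * tl x + d / 2 * tl x by field.
lra.
Qed.

Let mcY (k : R) i : measurable_fun setT (fun w => k * Yf i w).
Proof. exact: measurable_funM. Qed.

Lemma wsum_single c c' n i w : (forall j, (j < n)%N -> c j <= c' j) -> (i < n)%N ->
  wsum Yf c 0 n w + (c' i - c i) * Yf i w <= wsum Yf c' 0 n w.
Proof.
move=> cc ni; rewrite -lerBrDl /wsum -sumrB.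
rewrite (bigD1 (Ordinal ni))//= add0n -mulrBl lerDl; apply: sumr_ge0 => j _.
by rewrite -mulrBl mulr_ge0 ?subr_ge0 ?cc//; exact: Y0.
Qed.

Lemma measurable_no_jump c n x h : measurable
  [set w | x < wsum Yf c 0 n w /\ forall i, (i < n)%N -> c i * Yf i w <= x - h].
Proof.
apply: measurableI; first exact/measurable_gt/mW.
have -> : (fun w => forall i, (i < n)%N -> c i * Yf i w <= x - h) =
    \bigcap_i [set w | (i < n)%N -> c i * Yf i w <= x - h].
  by apply/seteqP; split => w /= H i; [move=> _; exact: H|exact: H].
apply: bigcapT_measurable => i; have [ni|ni] := boolP (i < n)%N.
  have -> : [set w | true -> c i * Yf i w <= x - h] = [set w | c i * Yf i w <= x - h].
    by apply/seteqP; split => w /=; [apply|].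
  exact: measurable_le.
by have -> : [set w | false -> c i * Yf i w <= x - h] = setT by apply/seteqP; split.
Qed.

(** Let T be the majorant of the sum with weights 1 for i < N and rho^i for i >= N.
    When Y_i > x with i < N and T - Y_i <= h, the rest of the sum is at most h, so
    that x can be exceeded only with c_i Y_i > x - h.  The event considered
    is thus disjoint from these N events, whose probabilities add up to about
    N tl x, that is, to almost all of P(x < T). *)
Lemma no_big_jump d : 0 < d -> exists2 h, 0 < h & \forall x \near +oo, forall n c,
  (forall i, (i < n)%N -> 0 <= c i <= rho ^+ i) ->
  pr P [set w | x < wsum Yf c 0 n w /\ forall i, (i < n)%N -> c i * Yf i w <= x - h]
    <= d * tl x.
Proof.
move=> d0; have d20 : 0 < d / 2 by lra.
have [N N0 HN] := total_tail d20.
have N1 : 1 <= N%:R :> R by rewrite ler1n.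
pose d' := d / (2 * N%:R).
have d'0 : 0 < d' by rewrite divr_gt0//; lra.
have d'E : N%:R * d' = d / 2 by rewrite /d'; field; lra.
have e0 : 0 < d' / (N%:R + d / 2) by rewrite divr_gt0//; lra.
have [h h0 Hh] := (near_pinftyP _).1 (near_pinfty_and HN (tail_small V e0)).
have {Hh} [Hh th] := Hh h (lexx _).
have {}Hh n : pr P [set w | h < W 0%N N w + rho ^+ N * Z N n w] <= d'.
  by apply: (le_trans (Hh n)); rewrite mulrC -ler_pdivlMr//; lra.
exists h => //; move: HN (near_pinfty_ge h); apply: filterS2 => x HN hx n c c01.
(* padding with zero weights to N + n terms, so that T dominates whatever n is *)
pose c' i := if (i < n)%N then c i else 0.
pose t j : R := if (j < N)%N then 1 else rho ^+ j.
have c't j : 0 <= c' j <= t j.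
  rewrite /c' /t; case: ifP => [/c01|_]; case: ifP => _.
  - by move=> /andP[-> /le_trans]; apply.
  - by [].
  - by rewrite lexx ler01.
  - by rewrite lexx rho_ge0.
have t_ge0 j : 0 <= t j by case/andP: (c't j) => /le_trans; apply.
have cE w : wsum Yf c 0 n w = wsum Yf c' 0 (N + n) w.
  rewrite addnC wsum_cat [X in _ + X](_ : _ = 0) ?addr0.
    by apply: eq_bigr => i _; rewrite /c' ltn_ord.
  by rewrite /wsum big1// => i _; rewrite /c' ltnNge leq_addr mul0r.
have tE w : wsum Yf t 0 (N + n) w = W 0%N N w + rho ^+ N * Z N n w.
  rewrite wsum_cat; congr (_ + _); first by apply: eq_bigr => i _; rewrite /t ltn_ord.
  rewrite -wsumZ; apply: eq_bigr => i _.
  by rewrite /t ltnNge leq_addr/= exprD add0n.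
set T := wsum Yf t 0 (N + n).
pose rest i := wsum Yf (fun j => if j == i then 0 else t j) 0 (N + n).
have restE i w : (i < N)%N -> T w = Yf i w + rest i w.
  move=> iN; have iNn : (i < N + n)%N by rewrite ltn_addr.
  rewrite /T /rest /wsum (bigD1 (Ordinal iNn))//= [in RHS](bigD1 (Ordinal iNn))//=.
  rewrite eqxx mul0r add0r /t iN mul1r add0n; congr (_ + _).
  by apply: eq_bigr => j /eqP ji; case: eqP => // ji'; case: ji; apply: val_inj.
have rest0 i w : 0 <= rest i w.
  by apply: wsum_ge0 => // j _; case: ifP.
set E2 := [set w | _ /\ _].
(* the N single-jump events, followed by the event to be estimated *)
pose F i : set Omega := if (i < N)%N then [set w | x < Yf i w] `&` [set w | rest i w <= h]
  else E2.
have mE2 : measurable E2 by exact: measurable_no_jump.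
have mF i : measurable (F i).
  rewrite /F; case: ifP => // _; apply: measurableI; first exact/measurable_gt/mY.
  exact/measurable_le/mW.
have E2h i w : E2 w -> (i < N)%N -> c' i * Yf i w <= x - h.
  move=> [_ H] iN; rewrite /c'; case: ifP => [/H//|_].
  by rewrite mul0r subr_ge0.
have E2T w : E2 w -> x < T w.
  move=> [+ _]; rewrite cE => /lt_le_trans; apply; apply: le_wsum => // i _.
  by case/andP: (c't i).
have FT : \sum_(i < N.+1) pr P (F i) <= pr P [set w | x < T w].
  apply: sum_pr_le => [|i _|i _ w|i j w ij]; [exact/measurable_gt/mW|exact: mF| |].
    rewrite /F; case: ifP => [iN [/= xY _]|_]; last exact: E2T.
    by rewrite (restE i)//; apply: (lt_le_trans xY); rewrite lerDl.
  rewrite ltnS => jN; have iN := leq_trans ij jN.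
  rewrite /F iN => -[/= xY rh]; case: ifP => [jN' [/= xYj _]|_ E2w].
    have H1 k : (k < N + n)%N -> 0 <= (if k == i then 0 else t k) by case: ifP.
    have := @wsum_single (fun=> 0) _ (N + n) j w H1 (ltn_addr n jN').
    rewrite subr0 -/(rest i w) (gtn_eqF ij) {1}/t jN' mul1r.
    rewrite (_ : wsum _ _ _ _ _ = 0) ?add0r; last first.
      by rewrite /wsum big1// => k _; rewrite mul0r.
    by lra.
  have iNn : (i < N + n)%N by rewrite ltn_addr.
  have := @wsum_single c' t (N + n) i w (fun j _ => proj2 (andP (c't j))) iNn.
  rewrite -/(T w) -cE (restE i)// /t iN mulrBl mul1r.
  by case: (E2w) => + _; have := E2h i w E2w iN; lra.
have PF i : (i < N)%N -> (1 - d') * tl x <= pr P (F i).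
  move=> iN; rewrite /F iN.
  have iYr : independent_pair P (Yf i) (rest i).
    apply: (depends_on_independent iY (D := [set i]) (D' := [set j | j != i])).
    - by apply/seteqP; split => // j [/= ->]; rewrite eqxx.
    - exact: depends_on_rv.
    - by apply: depends_on_wsum => j _; rewrite /= add0n; case: ifP; rewrite ?eqxx// => ->.
  have := pr_independent (mY _) (mW _ _ _) iYr (measurable_itv `]x, +oo[)
      (measurable_itv `]-oo, h]).
  have -> : rest i @^-1` `]-oo, h]%classic = [set w | rest i w <= h].
    by apply/seteqP; split => w /=; rewrite in_itv.
  have -> : Yf i @^-1` `]x, +oo[%classic = [set w | x < Yf i w].
    by apply/seteqP; split => w /=; rewrite in_itv/= andbT.
  move=> ->; rewrite (pr_tail lawY) mulrC ler_pM2l// pr_le_gt; last exact: mW.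
  rewrite lerD2l lerN2; apply: le_trans (Hh n).
  apply: le_pr => [||w /= hr]; [exact/measurable_gt/mW| |].
    apply: measurable_gt; apply: measurable_funD; first exact: mW.
    by apply: measurable_funM => //; exact: mW.
  rewrite -tE -/(T w) (restE i)//; apply: (lt_le_trans hr).
  by rewrite lerDr; exact: Y0.
have Fsum : N%:R * ((1 - d') * tl x) <= \sum_(i < N) pr P (F i).
  rewrite mulr_natl -[X in _ *+ X](card_ord N) -sumr_const.
  by apply: ler_sum => i _; exact: PF.
have := HN n; have -> : [set w | x < W 0%N N w + rho ^+ N * Z N n w] = [set w | x < T w].
  by apply/seteqP; split => w /=; rewrite /T tE.
move=> /(le_trans FT); rewrite big_ord_recr/= {2}/F ltnn.
have := V_gt0 x; nra.
Qed.

(** For weights bounded away from 0, lowering x by h lowers x / k by a bounded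
    amount, and long tails apply.  For small weights (x - h) / k is a large multiple
    of x, and positive decrease makes the probability negligible against tl x. *)
Lemma single_jump h d d' : 0 < h -> 0 < d -> 0 < d' -> \forall x \near +oo,
  forall k i, 0 <= k <= 1 ->
  pr P [set w | x - h < k * Yf i w] <=
    (1 + d) * pr P [set w | x < k * Yf i w] + d' * tl x.
Proof.
move=> h0 d0 d'0; have [u u1 Hu] := pd_small V_gt0 V_pd d'0.
have uh0 : 0 < 2 * u * h by rewrite !mulr_gt0//; lra.
have /near_pinftyP[M M0 HM] := long_tailed iY lawY Y0 V_gt0 V_subexp uh0 d0.
move: Hu (near_pinfty_ge M) (near_pinfty_ge (2 * h)); apply: filterS3.
move=> x Hu Mx hx k i /andP[k0 k1].
have p0 := pr_ge0 P [set w | x < k * Yf i w].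
have t0 := V_gt0 x.
have [->|k_neq0] := eqVneq k 0.
  rewrite (_ : [set w | _] = set0) ?[pr P set0]/pr ?measure0.
    by rewrite addr_ge0// mulr_ge0 ?pr_ge0//; lra.
  by apply/seteqP; split => // w /=; rewrite mul0r; lra.
have {k_neq0}k0 : 0 < k by rewrite lt_neqAle eq_sym k_neq0.
have E y : pr P [set w | y < k * Yf i w] = tl (y / k).
  rewrite -(pr_tail lawY i); congr (pr P _).
  by apply/seteqP; split => w /=; rewrite ltr_pdivrMr// mulrC.
rewrite !E; have [ku|ku] := leP (k * (2 * u)) 1.
  have : tl ((x - h) / k) <= d' * tl x.
    apply: Hu; rewrite ler_pdivlMr//; nra.
  by have := tail_ge0 V (x / k); nra.
have H : M <= x / k.
  by apply: (le_trans Mx); rewrite ler_pdivlMr// ler_piMr//; lra.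
have := HM _ H; have : tl ((x - h) / k) <= tl (x / k - 2 * u * h).
  apply: le_tail; rewrite mulrBl lerD2l lerN2 ler_pdivrMr//; nra.
by nra.
Qed.

Lemma weighted_upper d : 0 < d -> \forall x \near +oo, forall n c,
  (0 < n)%N -> c 0%N = 1 -> (forall i, (i < n)%N -> 0 <= c i <= rho ^+ i) ->
  pr P [set w | x < wsum Yf c 0 n w] <=
    (1 + d) * \sum_(i < n) pr P [set w | x < c i * Yf i w].
Proof.
move=> d0; pose e := d / 4; have e0 : 0 < e by rewrite /e; lra.
have [h h0 Hh] := no_big_jump e0.
have [J HJ] := pd_sum_tail V_gt0 V_pd rho01 e0.
have J0 : 0 < J.+1%:R :> R by rewrite ltr0n.
have e'0 : 0 < e / J.+1%:R by rewrite divr_gt0.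
have HS := single_jump h0 e0 e'0.
move: (near_pinfty_and Hh HJ) HS (near_pinfty_ge (2 * h)); apply: filterS3.
move=> x [{}Hh {}HJ] HS hx n c n0 c0 c01.
set E2 := [set w | x < wsum Yf c 0 n w /\ forall i, (i < n)%N -> c i * Yf i w <= x - h].
have mE2 : measurable E2 by exact: measurable_no_jump.
(* one event per term, and the event without a large term in position n *)
pose F i : set Omega := if (i < n)%N then [set w | x - h < c i * Yf i w] else E2.
have mF i : measurable (F i).
  by rewrite /F; case: ifP => // _; exact: measurable_gt.
have : pr P [set w | x < wsum Yf c 0 n w] <= \sum_(i < n.+1) pr P (F i).
  apply: pr_le_sum => [|i _|w /= xw]; [exact/measurable_gt/mW|exact: mF|].
  have [[i ni Fi]|nF] := pselect (exists2 i, (i < n)%N & x - h < c i * Yf i w).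
    by exists i; rewrite /F ?ni// ltnW.
  exists n => //; rewrite /F ltnn; split => // i ni; rewrite leNgt; apply/negP => xc.
  by apply: nF; exists i.
rewrite big_ord_recr/= {2}/F ltnn => /le_trans; apply.
(* error of the i-th term: [single_jump] for the first J terms, and beyond
   them the tail of a convergent series, using x - h >= x / 2 *)
pose g i := if (i < J)%N then e / J.+1%:R * tl x else tl (x / (2 * rho ^+ i)).
have g0 i : 0 <= g i.
  by rewrite /g; case: ifP; rewrite ?tail_ge0// mulr_ge0 ?tail_ge0// ltW.
have Fi i : (i < n)%N ->
    pr P (F i) <= (1 + e) * pr P [set w | x < c i * Yf i w] + g i.
  move=> ni; have /andP[ci0 ci1] := c01 i ni.
  rewrite /F ni /g; case: ifP => iJ.
    by apply: HS; rewrite ci0 (le_trans ci1).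
  have p0 := pr_ge0 P [set w | x < c i * Yf i w].
  apply: (@le_trans _ _ (tl (x / (2 * rho ^+ i)))); last by nra.
  rewrite -(pr_tail lawY i); apply: le_pr => [||w /=]; [exact: measurable_gt| |].
    exact/measurable_gt/mY.
  have : c i * Yf i w <= rho ^+ i * Yf i w by apply: ler_wpM2r => //; exact: Y0.
  rewrite ltr_pdivrMr; last by rewrite mulr_gt0.
  by rewrite -/(Yf i w); set y := Yf i w; set r := rho ^+ i; move=> *; nra.
have gs : \sum_(i < n) g i <= 2 * e * tl x.
  apply: (@le_trans _ _ (\sum_(i < J + n) g i)).
    by rewrite addnC big_split_ord/= lerDl; apply: sumr_ge0 => i _.
  have -> : 2 * e * tl x = e * tl x + e * tl x by ring.
  rewrite big_split_ord/=; apply: lerD.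
    under eq_bigr => i _ do rewrite /g ltn_ord.
    rewrite sumr_const card_ord -mulrnAl ler_wpM2r ?tail_ge0//.
    rewrite -mulr_natr -mulrA ler_piMr ?(ltW e0)// mulrC ler_pdivrMr// mul1r.
    by rewrite ler_nat.
  under eq_bigr => i _ do rewrite /g ltnNge leq_addr/=.
  exact: HJ.
have Fs : \sum_(i < n) pr P (F i) <=
    (1 + e) * \sum_(i < n) pr P [set w | x < c i * Yf i w] + \sum_(i < n) g i.
  by rewrite mulr_sumr -big_split/=; apply: ler_sum => i _; exact: Fi.
have p0 : tl x <= \sum_(i < n) pr P [set w | x < c i * Yf i w].
  rewrite (bigD1 (Ordinal n0))//= c0 -(pr_tail lawY 0%N).
  rewrite (_ : [set w | x < 1 * _] = [set w | x < Y 0%N w]).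
    by rewrite lerDl; apply: sumr_ge0 => i _; exact: pr_ge0.
  by apply/seteqP; split => w /=; rewrite mul1r.
have := Hh n c c01; rewrite -/E2; have := V_gt0 x.
move: Fs gs p0; set s := \sum_(i < n) pr P [set w | _]; rewrite /e.
by set G := \sum_(i < n) g i; move=> *; nra.
Qed.

Lemma weighted_lower d : 0 < d -> \forall x \near +oo, forall n c,
  (forall i, (i < n)%N -> 0 <= c i <= rho ^+ i) ->
  (1 - d) * \sum_(i < n) pr P [set w | x < c i * Yf i w] <=
  pr P [set w | exists2 i, (i < n)%N & x < c i * Yf i w].
Proof.
move=> d0; have [C C0 HC] := pd_sum V_gt0 V_pd rho01.
move: HC (tail_small V (divr_gt0 d0 C0)) (near_pinfty_ge (0 : R)); apply: filterS3.
move=> x HC Hx x0 n c c01.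
pose F i := [set w | x < c i * Yf i w].
have mF i : measurable (F i) by exact: measurable_gt.
set U := mkset _.
have mU : measurable U.
  rewrite (_ : U = \bigcup_(i in [set i | (i < n)%N]) F i).
    by apply: bigcup_measurable.
  by apply/seteqP; split => w [i ni Fi]; exists i.
have IF i j : (i < j)%N -> (j < n)%N -> pr P (F i `&` F j) = pr P (F i) * pr P (F j).
  move=> ij jn.
  have iij : independent_pair P (fun w => c i * Yf i w) (fun w => c j * Yf j w).
    apply: (depends_on_independent iY (D := [set i]) (D' := [set j])).
    - by apply/seteqP; split => // k [/= ->] ijE; rewrite ijE ltnn in ij.
    - by apply: depends_onZ; exact: depends_on_rv.
    - by apply: depends_onZ; exact: depends_on_rv.
  have := pr_independent (mcY _ _) (mcY _ _) iij (measurable_itv `]x, +oo[)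
      (measurable_itv `]x, +oo[).
  have e k : (fun w => c k * Yf k w) @^-1` `]x, +oo[%classic = F k.
    by apply/seteqP; split => w /=; rewrite in_itv/= andbT.
  by rewrite !e.
have FU i : (i < n)%N -> F i `<=` U by move=> ni w Fi; exists i.
apply: le_trans (@sum_sub_sqr_le_pr _ _ _ P n U F mU (fun i _ => mF i) FU IF).
have : \sum_(i < n) pr P (F i) <= d.
  apply: (@le_trans _ _ (C * tl x)); last by rewrite mulrC -ler_pdivlMr.
  apply: le_trans (HC n); apply: ler_sum => i _; rewrite -(pr_tail lawY i).
  have /andP[ci0 ci1] := c01 i (ltn_ord i).
  apply: le_pr => [||w]; [exact: mF|exact/measurable_gt/mY|].
  rewrite /F/= ltr_pdivrMr// [Y i w * _]mulrC => /lt_le_trans; apply.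
  by apply: ler_wpM2r => //; exact: Y0.
have : 0 <= \sum_(i < n) pr P (F i) by apply: sumr_ge0 => i _; exact: pr_ge0.
by set s := \sum_(i < n) _; nra.
Qed.

(** Dividing the weights and the level x by c_0 <= 1 reduces the upper bound to
    c_0 = 1; the level only grows, so the threshold on x is kept. *)
Lemma weighted_one_big_jump d : 0 < d -> \forall x \near +oo, forall n c,
  (forall i, (i < n)%N -> 0 <= c i <= rho ^+ i * c 0%N) -> c 0%N <= 1 ->
  (1 - d) * \sum_(i < n) pr P [set w | x < c i * Yf i w] <=
    pr P [set w | exists2 i, (i < n)%N & x < c i * Yf i w] /\
  pr P [set w | x < wsum Yf c 0 n w] <=
    (1 + d) * \sum_(i < n) pr P [set w | x < c i * Yf i w].
Proof.
move=> d0; have /near_pinftyP[M M0 HM] := weighted_upper d0.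
move: (weighted_lower d0) (near_pinfty_ge M); apply: filterS2 => x HL Mx [|n] c c0 c1.
  split; first by rewrite big_ord0 mulr0 pr_ge0.
  rewrite big_ord0 mulr0 (_ : [set w | _] = set0) /pr ?measure0//.
  apply/seteqP; split => // w /=; rewrite /wsum big_ord0; have := lt_le_trans M0 Mx.
  by move=> /lt_trans h /h; rewrite ltxx.
have x0 : 0 < x by exact: lt_le_trans Mx.
have c00 : 0 <= c 0%N by have /andP[] := c0 0%N isT.
split.
  apply: HL => i ni; have /andP[-> /le_trans] := c0 i ni; apply.
  by rewrite ler_piMr.
have [c0E|c0N] := eqVneq (c 0%N) 0.
  have cE i : (i < n.+1)%N -> c i = 0.
    move=> /c0; rewrite c0E mulr0 => /andP[? ?]; apply/eqP; rewrite eq_le.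
    by apply/andP.
  rewrite (_ : [set w | x < wsum _ _ _ _ w] = set0).
    rewrite {1}/pr measure0 mulr_ge0//; first by lra.
    by apply: sumr_ge0 => i _; exact: pr_ge0.
  apply/seteqP; split => // w /=; rewrite /wsum big1 ?ltNge ?(ltW x0)// => i _.
  by rewrite cE// mul0r.
have {c0N}cgt0 : 0 < c 0%N by rewrite lt_neqAle eq_sym c0N.
have Mxc : M <= x / c 0%N.
  by apply: (le_trans Mx); rewrite ler_pdivlMr// ler_piMr// ltW.
have := HM _ Mxc n.+1 (fun i => (c 0%N)^-1 * c i) isT (mulVf (lt0r_neq0 cgt0)).
have -> : [set w | x / c 0%N < wsum Yf (fun i => (c 0%N)^-1 * c i) 0 n.+1 w] =
    [set w | x < wsum Yf c 0 n.+1 w].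
  apply/seteqP; split => w /=; rewrite wsumZ [_ * wsum _ _ _ _ _]mulrC ltr_pM2r//;
    by rewrite invr_gt0.
rewrite (eq_bigr (fun i : 'I_n.+1 => pr P [set w | x < c i * Yf i w])); last first.
  move=> i _; congr (pr P _); apply/seteqP; split => w /=;
    by rewrite -mulrA [_ * (c i * _)]mulrC ltr_pM2r// invr_gt0.
apply => i /c0 /andP[ci0 ci1]; apply/andP; split.
  by rewrite mulr_ge0// invr_ge0.
by rewrite mulrC ler_pdivrMr.
Qed.

End one_big_jump.

(** * Radial functional and Borel sets of row vectors *)

Section radial_sums.
Context {R : realType} {d : nat}.
Variables (A : set 'rV[R]_d) (hA : risk_set A).
Implicit Types (x y : 'rV[R]_d) (u v c : R).

Lemma nonneg_rVD x y : nonneg_rV x -> nonneg_rV y -> nonneg_rV (x + y).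
Proof. by move=> x0 y0 j; rewrite mxE addr_ge0. Qed.

Lemma nonneg_rVZ c x : 0 <= c -> nonneg_rV x -> nonneg_rV (c *: x).
Proof. by move=> c0 x0 j; rewrite mxE mulr_ge0. Qed.

Lemma nonneg_rV_sum n (X : nat -> 'rV[R]_d) : (forall i, nonneg_rV (X i)) ->
  nonneg_rV (\sum_(i < n) X i).
Proof. by move=> X0 j; rewrite summxE sumr_ge0// => i _; exact: X0. Qed.

Lemma dilate_le u v x : nonneg_rV x -> 0 < u -> u <= v -> dilate v A x -> dilate u A x.
Proof.
move=> x0 u0 uv; have v0 : 0 < v by exact: lt_le_trans uv.
case: hA => _ _ iA _ _; rewrite !dilateE//= => Ax.
have -> : u^-1 *: x = v^-1 *: x + (u^-1 - v^-1) *: x.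
  by rewrite -scalerDl; congr (_ *: _); ring.
by apply: iA => //; apply: nonneg_rVZ => //; rewrite subr_ge0 lef_pV2.
Qed.

(** Openness of A makes the supremum defining [radial] strict, and x in v A
    passes to smaller dilations because x is nonnegative and A increasing. *)
Lemma dilateP u x : nonneg_rV x -> 0 < u -> dilate u A x <-> u < radial A x.
Proof.
move=> x0 u0; have [_ oA _ _ cA] := hA; split; last first.
  have [E0|/set0P E0] := eqVneq [set u | 0 < u /\ dilate u A x] set0.
    by rewrite /radial E0 sup0 ltNge (ltW u0).
  by move=> /(sup_gt E0)[v [v0 vx] /ltW uv]; exact: dilate_le vx.
rewrite dilateE//= => Ax.
have : nbhs (u^-1) [set v | A (v *: x)].
  have /(_ u^-1) : continuous (fun v : R => v *: x) by exact: scalel_continuous.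
  by apply; exact: open_nbhs_nbhs.
move=> /nbhs_ballP[e /= e0 He].
have ui : 0 < u^-1 by rewrite invr_gt0.
(* a point of the ball around 1 / u that is smaller but still positive *)
pose v := u^-1 - Num.min (e / 2) (u^-1 / 2).
have [m0 me mu] : [/\ 0 < Num.min (e / 2) (u^-1 / 2), Num.min (e / 2) (u^-1 / 2) < e &
    Num.min (e / 2) (u^-1 / 2) < u^-1].
  by split; rewrite ?lt_min ?gt_min; lra.
have v0 : 0 < v by rewrite subr_gt0.
have Av : A (v *: x).
  by apply: He; rewrite /ball/= /v opprB addrCA subrr addr0 gtr0_norm.
apply: (@lt_le_trans _ _ v^-1).
  by rewrite -[ltLHS]invrK ltf_pV2 ?posrE// /v ltrBlDr ltrDl.
apply: ub_le_sup; first exact: radial_bounded.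
by split; rewrite ?invr_gt0// dilateE ?invr_gt0//= invrK.
Qed.

(** If x is outside s A and y outside t A, then (x + y) / (s + t) is a convex
    combination of x / s and y / t, hence outside A by convexity of its complement. *)
Lemma radialD x y : nonneg_rV x -> nonneg_rV y ->
  radial A (x + y) <= radial A x + radial A y.
Proof.
move=> x0 y0; rewrite leNgt; apply/negP => lt.
have [_ _ _ vA _] := hA.
have rx := radial_ge0 A x; have ry := radial_ge0 A y.
(* a third of the gap, so that s + t stays below radial A (x + y) *)
pose e := (radial A (x + y) - radial A x - radial A y) / 3.
pose s := radial A x + e; pose t := radial A y + e.
have e0 : 0 < e by rewrite /e; lra.
have s0 : 0 < s by rewrite /s; lra.
have t0 : 0 < t by rewrite /t; lra.
have st : s + t < radial A (x + y) by rewrite /s /t /e; lra.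
have st0 : 0 < s + t by lra.
have nx : ~ dilate s A x by move/dilateP => /(_ x0 s0); rewrite /s; lra.
have ny : ~ dilate t A y by move/dilateP => /(_ y0 t0); rewrite /t; lra.
have := (dilateP (nonneg_rVD x0 y0) st0).2 st.
rewrite !dilateE//= in nx ny *.
have l0 : 0 <= s / (s + t) by apply: divr_ge0; lra.
have l1 : s / (s + t) <= 1 by rewrite ler_pdivrMr// mul1r; lra.
have := vA (s^-1 *: x) (t^-1 *: y) (Itv01 l0 l1).
rewrite !inE => /(_ nx ny); rewrite /conv/= /unstable.onem !scalerA.
have -> : s / (s + t) / s = (s + t)^-1 by field; lra.
have -> : (1 - s / (s + t)) / t = (s + t)^-1 by field; lra.
by rewrite -scalerDr.
Qed.

Lemma radial0 : radial A 0 = 0.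
Proof.
rewrite /radial (_ : [set u | _] = set0) ?sup0//; apply/seteqP; split => // u /= [u0].
have [_ _ _ _ cA] := hA.
by rewrite dilateE//= scaler0 => A0; apply: cA; exact: subset_closure.
Qed.

Lemma radialZ c x : 0 <= c -> nonneg_rV x -> radial A (c *: x) <= c * radial A x.
Proof.
rewrite le_eqVlt => /orP[/eqP <-|c0] x0; first by rewrite scale0r mul0r radial0.
rewrite leNgt; apply/negP => lt.
have r0 := radial_ge0 A x.
pose u := (c * radial A x + radial A (c *: x)) / 2.
have cr : 0 <= c * radial A x by rewrite mulr_ge0// ltW.
have u0 : 0 < u by rewrite /u; lra.
have ux : u < radial A (c *: x) by rewrite /u; lra.
have := (dilateP (nonneg_rVZ (ltW c0) x0) u0).2 ux.
have uc : 0 < u / c by rewrite divr_gt0.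
have cu : u^-1 * c = (u / c)^-1 by rewrite (invf_div u c) mulrC.
rewrite dilateE//= scalerA cu => Ax.
have := (dilateP x0 uc).1 _; rewrite dilateE// => /(_ Ax).
by rewrite ltr_pdivrMr// mulrC /u; lra.
Qed.

Lemma radial_sum n (c : nat -> R) (X : nat -> 'rV[R]_d) :
  (forall i, 0 <= c i) -> (forall i, nonneg_rV (X i)) ->
  radial A (\sum_(i < n) c i *: X i) <= \sum_(i < n) c i * radial A (X i).
Proof.
move=> c0 X0; elim: n => [|n IH]; first by rewrite !big_ord0 radial0.
have cX i : nonneg_rV (c i *: X i) by exact: nonneg_rVZ.
rewrite !big_ord_recr/=; apply: le_trans (lerD IH (radialZ (c0 n) (X0 n))).
by apply: radialD => //; exact: (nonneg_rV_sum n cX).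
Qed.

Lemma le_radial_sum n (c : nat -> R) (X : nat -> 'rV[R]_d) i u :
  (forall i, 0 <= c i) -> (forall i, nonneg_rV (X i)) -> (i < n)%N -> 0 < u ->
  u < c i * radial A (X i) -> dilate u A (\sum_(i < n) c i *: X i).
Proof.
move=> c0 X0 ni u0 uc; have [_ _ iA _ _] := hA.
have ci : 0 < c i.
  by rewrite lt_neqAle c0 andbT; apply: contraTneq uc => <-; rewrite mul0r -leNgt ltW.
have cX j : nonneg_rV (c j *: X j) by exact: nonneg_rVZ.
have : dilate (u / c i) A (X i).
  by apply/dilateP => //; rewrite ?divr_gt0// ltr_pdivrMr// mulrC.
rewrite !dilateE ?divr_gt0//= invfM invrK mulrC => AX.
rewrite (bigD1 (Ordinal ni))//= scalerDr scalerA; apply: iA => //.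
  by rewrite mulrC.
apply: nonneg_rVZ; first by rewrite invr_ge0 ltW.
by move=> k; rewrite summxE; apply: sumr_ge0 => j _; exact: cX.
Qed.

End radial_sums.

Section borel_coordinates.
Context {R : realType} {d : nat}.
Context {dT : measure_display} {T : measurableType dT}.

Lemma measurable_coord (X : T -> borel_rV R d) j :
  measurable_fun setT X -> measurable_fun setT (fun w => (X w : 'rV[R]_d) ord0 j).
Proof.
move=> mX; apply: (measurability _ (RGenOInfty.measurableE R)).
move=> _ [_ [c ->] <-]; rewrite setTI.
have oU : open [set y : 'rV[R]_d | c < y ord0 j].
  have := @open_comp _ _ (fun y : 'rV[R]_d => y ord0 j) [set z | c < z] _ (@open_gt _ c).
  by apply => y _; exact: coord_continuous.
have mU : measurable ([set y | c < y ord0 j] : set (borel_rV R d)).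
  exact: sub_sigma_algebra.
have := mX measurableT _ mU; rewrite setTI.
by congr measurable; apply/seteqP; split => w /=; rewrite in_itv/= andbT.
Qed.

Definition box (qk : 'rV[rat]_d * nat) : set 'rV[R]_d :=
  [set x | forall j, `|x ord0 j - ratr (qk.1 ord0 j)| < qk.2.+1%:R^-1].

Lemma open_box (U : set 'rV[R]_d) x : open U -> U x ->
  exists2 qk, box qk x & box qk `<=` U.
Proof.
move=> oU Ux; have /nbhs_ballP[e /= e0 He] := open_nbhs_nbhs (conj oU Ux).
have e20 : 0 < e / 2 by lra.
have [k _ Hk] := near_infty_natSinv_lt (PosNum e20).
have {}Hk := Hk k (leqnn k); rewrite /= in Hk.
have k0 : 0 < k.+1%:R^-1 :> R by rewrite invr_gt0.
have q j : exists q : rat, `|x ord0 j - ratr q| < k.+1%:R^-1.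
  move: k0; set a := k.+1%:R^-1 => a0.
  have [q] := @rat_in_itvoo R (x ord0 j - a) (x ord0 j + a) ltac:(lra).
  rewrite in_itv/= => /andP[q1 q2]; exists q.
  by rewrite ltr_norml; apply/andP; split; lra.
have [f Hf] := choice q.
exists (\row_j f j, k); first by move=> j; rewrite mxE.
move=> y Hy; apply: He; split => // i j; rewrite (ord1 i) /ball/=.
have := Hy j; have := Hf j; rewrite /= mxE; move: Hk; set a := k.+1%:R^-1 => Hk.
rewrite !ltr_norml => /andP[? ?] /andP[? ?].
by apply/andP; split; lra.
Qed.

(** An open set is the countable union of the rational boxes it contains, and
    boxes are described by coordinates. *)
Lemma measurable_rV (f : T -> 'rV[R]_d) :
  (forall j, measurable_fun setT (fun w => f w ord0 j)) ->
  forall U, open U -> measurable (f @^-1` U).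
Proof.
move=> mf U oU.
have -> : f @^-1` U = \bigcup_(qk in setT)
    if `[< box qk `<=` U >] then f @^-1` box qk else set0.
  apply/seteqP; split => w /=.
    by move=> /(open_box oU)[qk bx bU]; exists qk => //; rewrite asboolT.
  by move=> [qk _]; case: asboolP => // bU; exact: bU.
apply: countable_bigcupT_measurable; first exact: countableP.
move=> qk; case: asboolP => // _.
have -> : f @^-1` box qk = \bigcap_(j in setT)
    [set w | `|f w ord0 j - ratr (qk.1 ord0 j)| < qk.2.+1%:R^-1].
  by apply/seteqP; split => w /= H j; [move=> _|]; exact: H.
apply: fin_bigcap_measurable; first exact: finite_finset.
move=> j _; rewrite -[X in measurable X]setTI; apply: measurable_fun_ltr => //.
by apply: measurableT_comp => //; exact: measurable_funB.
Qed.

End borel_coordinates.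

(** * Renewal arrivals *)

Section generated_identity.
Context {dO : measure_display} {Omega : measurableType dO}.
Context {dE : measure_display} {E : measurableType dE} {I : Type}.

Lemma measurable_to_generated (D : set I) (X : I -> Omega -> E) :
  (forall i, D i -> measurable_fun setT (X i)) ->
  measurable_fun setT (id : Omega -> generated_space D X).
Proof.
move=> mX _ B sB; rewrite setTI preimage_id; move: B sB.
apply: smallest_sub; first exact: sigma_algebra_measurable.
by move=> _ [i [B [Di mB ->]]]; rewrite -[X in measurable X]setTI; exact: mX.
Qed.

End generated_identity.

Section renewal_process.
Context {dO : measure_display} {Omega : measurableType dO} {R : realType}.
Variables (P : probability Omega R) (theta : nat -> {RV P >-> R}).
Hypothesis theta_ge0 : forall i w, 0 <= theta i w.
Implicit Types (t : R) (w : Omega) (n : nat).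

Local Notation tau := (arrival theta).
Local Notation N := (renewal_count theta).

Lemma arrivalS n w : tau n.+1 w = tau n w + theta n w.
Proof. by rewrite /arrival big_ord_recr. Qed.

Lemma le_arrival w : {homo (fun n => tau n w) : m n / (m <= n)%N >-> m <= n}.
Proof.
move=> m n /subnK <-; elim: (n - m)%N => [|k IH]//.
by rewrite addSn arrivalS; apply: (le_trans IH); rewrite lerDl.
Qed.

Lemma arrival_ge0 n w : 0 <= tau n w.
Proof. by apply: sumr_ge0. Qed.

(** The supremum is over an initial segment of the integers, as arrival times
    increase; a value >= n forces n into that segment, even if the supremum is infinite. *)
Lemma arrival_le_count n t w : 0 <= t ->
  tau n w <= t <-> (n%:R%:E <= N t w)%E.
Proof.
move=> t0; split=> [nt|]; first by apply: ereal_sup_ubound; exists n.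
case: n => [|n]; first by rewrite /arrival big_ord0.
move=> nN; have : (n%:R%:E < N t w)%E.
  by apply: lt_le_trans nN; rewrite lte_fin ltr_nat.
move=> /ereal_sup_gt[_ [k /= kt <-]]; rewrite lte_fin ltr_nat => nk.
by apply: le_trans kt; exact: le_arrival.
Qed.

Lemma measurable_renewal_count t : measurable_fun setT (N t).
Proof.
apply: (measurability _ (ErealGenOInfty.measurableE R)).
move=> _ [_ [c ->] <-]; rewrite setTI.
have -> : N t @^-1` `]c%:E, +oo[%classic =
    \bigcup_(n in [set n | c < n%:R]) [set w | tau n w <= t].
  apply/seteqP; split => w /=; rewrite in_itv/= andbT.
    move=> /ereal_sup_gt[_ [n /= nt <-]]; rewrite lte_fin => cn.
    by exists n.
  move=> [n /= cn nt]; apply: (@lt_le_trans _ _ (n%:R%:E)); first by rewrite lte_fin.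
  by apply: ereal_sup_ubound; exists n.
by apply: bigcup_measurable => n _; exact/measurable_le/measurable_arrival.
Qed.

Let T2 := generated_space [set t : R | 0 <= t] N.

(** Arrival times are functions of the counting process, so the independence of
    claims and counting process extends to the arrival times. *)
Lemma measurable_arrival_count n : measurable_fun setT (tau n : T2 -> R).
Proof.
apply: (measurability _ (RGenOInfty.measurableE R)).
move=> _ [_ [c ->] <-]; rewrite setTI.
have [c0|c0] := ltP c 0.
  rewrite (_ : _ @^-1` _ = setT)//; apply/seteqP; split => // w _ /=.
  by rewrite in_itv/= andbT (lt_le_trans c0)// arrival_ge0.
have -> : (tau n : T2 -> R) @^-1` `]c, +oo[%classic =
    ~` ((N c : T2 -> \bar R) @^-1` `[n%:R%:E, +oo[%classic).
  apply/seteqP; split => w /=; rewrite !in_itv/= !andbT.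
    by move=> ct /(arrival_le_count _ _ c0); rewrite leNgt ct.
  by move=> nN; rewrite ltNge; apply/negP => /(arrival_le_count _ _ c0).
apply: measurableC; rewrite -[X in measurable X]setTI.
by apply: measurable_generated => //; exact: emeasurable_itv.
Qed.

Lemma measurable_theta_count n : measurable_fun setT (theta n : T2 -> R).
Proof.
have -> : (theta n : T2 -> R) = (fun w => tau n.+1 w - tau n w).
  by apply/funext => w; rewrite arrivalS addrC addKr.
by apply: measurable_funB; exact: measurable_arrival_count.
Qed.

Lemma measurable_id_count : measurable_fun setT (id : Omega -> T2).
Proof. by apply: measurable_to_generated => t _; exact: measurable_renewal_count. Qed.

Variable eps : R.
Hypothesis eps0 : 0 < eps.
Hypothesis theta_iid : iid theta.
Hypothesis theta_gap : P [set w | eps < theta 0%N w] = 1%E.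

(** An almost sure event, on which arrival times grow at least linearly. *)
Definition spaced : set Omega := [set w | forall i, eps < theta i w].

Lemma measurable_spaced_count : measurable (spaced : set T2).
Proof.
have -> : (spaced : set T2) = \bigcap_i [set w | eps < theta i w].
  by apply/seteqP; split => w /= H i; [move=> _|]; exact: H.
apply: bigcapT_measurable => i; apply: measurable_gt.
exact: measurable_theta_count.
Qed.

Lemma measurable_spaced : measurable spaced.
Proof.
have := measurable_id_count measurableT measurable_spaced_count.
by rewrite setTI.
Qed.

Lemma negligible_not_spaced : P.-negligible (~` spaced).
Proof.
have -> : ~` spaced = \bigcup_i [set w | theta i w <= eps].
  apply/seteqP; split => w /=.
    by move=> /existsNP[i /negP]; rewrite -leNgt => ?; exists i.
  by move=> [i _ /= le] /(_ i); rewrite ltNge le.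
apply: negligible_bigcup => i.
have mi : measurable [set w | eps < theta i w].
  by apply: measurable_gt; exact: measurable_funPT.
have -> : [set w | theta i w <= eps] = ~` [set w | eps < theta i w].
  by apply/seteqP; split => w /=; [rewrite leNgt => /negP|move=> /negP; rewrite -leNgt].
have e j : [set w | eps < theta j w] = theta j @^-1` `]eps, +oo[%classic.
  by apply/seteqP; split => w /=; rewrite in_itv/= andbT.
have P0 : P (~` [set w | eps < theta i w]) = 0%E.
  have [_ /(_ i `]eps, +oo[%classic)] := theta_iid.
  by rewrite -!e theta_gap probability_setC// => ->//; rewrite subee.
by apply/negligibleP => //; exact: measurableC.
Qed.

Lemma spaced_arrival n k w : spaced w -> tau n w + k%:R * eps <= tau (n + k) w.
Proof.
move=> sw; elim: k => [|k IH]; first by rewrite mul0r addr0 addn0.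
by rewrite addnS arrivalS -natr1; have := sw (n + k)%N; lra.
Qed.

Lemma spaced_arrival_gt t n w : 0 <= t -> spaced w -> ((Num.truncn (t / eps)).+1 <= n)%N ->
  t < tau n w.
Proof.
move=> t0 sw nt; have := spaced_arrival 0 n sw.
rewrite /arrival big_ord0 add0r add0n; apply: lt_le_trans.
by rewrite -ltr_pdivrMr//; apply: (lt_le_trans (truncnS_gt _)); rewrite ler_nat.
Qed.

End renewal_process.

(** * Discounted aggregate claims *)

Section discounted.
Context {R : realType} {d : nat}.
Variables (A : set 'rV[R]_d) (hA : risk_set A).
Context {dO : measure_display} {Omega : measurableType dO}.
Variables (P : probability Omega R) (F : probability (borel_rV R d) R).
Variables (X : nat -> {RV P >-> borel_rV R d}) (theta : nat -> {RV P >-> R}) (r : R).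
Hypothesis X_ge0 : forall i w, nonneg_rV (X i w).
Hypothesis X_iid : iid X.
Hypothesis X_law : forall B : set (borel_rV R d),
  measurable B -> P (X 0%N @^-1` B) = F B.
Hypothesis theta_ge0 : forall i w, 0 <= theta i w.
Hypothesis theta_iid : iid theta.
Hypothesis X_N_independent : independent_systems P (sigma_of setT X)
  (sigma_of [set t : R | 0 <= t] (renewal_count theta)).
Hypothesis F_class : multivariate_class_A hA F.
Variable eps : R.
Hypothesis eps0 : 0 < eps.
Hypothesis theta_gap : P [set w | (eps < theta 0%N w)%R] = 1%E.
Hypothesis r_gt0 : 0 < r.
Implicit Types (t x : R) (w : Omega) (i n : nat).

Local Notation tau := (arrival theta).
Local Notation V := (radial_law hA F).
Local Notation tl := (tail V).
Let rho := expR (- (r * eps)).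
Let Xf : nat -> Omega -> borel_rV R d := X.
Let T1 := generated_space [set: nat] Xf.
Let T2 := generated_space [set t : R | 0 <= t] (renewal_count theta).

Lemma measurable_claim_size i : measurable_fun setT (fun w => radial A (X i w)).
Proof. by apply: measurableT_comp => //; exact: measurable_radial. Qed.

(** Bundled as a random variable, to which the results on independent
    real variables apply. *)
Definition claim_size i : {RV P >-> R} := HB.pack (fun w => radial A (X i w))
  (isMeasurableFun.Build _ _ _ _ _ (measurable_claim_size i)).

Let Yf : nat -> Omega -> R := claim_size.

Let measurable_radial_preimage (B : set R) : measurable B ->
  measurable (radial A @^-1` B : set (borel_rV R d)).
Proof.
by move=> mB; rewrite -[X in measurable X]setTI; exact: (measurable_radial hA).
Qed.

Lemma claim_size_independent : mutually_independent claim_size.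
Proof.
move=> J B uJ mB; have [iX _] := X_iid.
exact: (iX J (fun i => radial A @^-1` B i) uJ (fun i => measurable_radial_preimage (mB i))).
Qed.

Lemma claim_size_law i (B : set R) : measurable B -> P (claim_size i @^-1` B) = V B.
Proof.
move=> mB; have mB' := measurable_radial_preimage mB.
have [_ /(_ i _ mB') E] := X_iid.
by rewrite [LHS]E X_law.
Qed.

Lemma claim_size_ge0 i w : 0 <= claim_size i w.
Proof. exact: radial_ge0. Qed.

Lemma tail_gt0 x : 0 < tl x. Proof. by case: F_class. Qed.

Lemma F_dilate u : 0 < u -> fine (F (dilate u A)) = tl u.
Proof.
move=> u0; have mU : measurable (dilate u A : set (borel_rV R d)).
  by apply: sub_sigma_algebra; apply: open_dilate => //; case: hA.
rewrite -X_law// -(pr_tail claim_size_law 0%N); congr (fine (P _)).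
by apply/seteqP; split => w /=; apply dilateP => //; exact: X_ge0.
Qed.

Lemma rho01 : 0 < rho < 1.
Proof. by rewrite expR_gt0 expR_lt1 oppr_lt0 mulr_gt0. Qed.

Definition paid t i : set Omega := spaced theta eps `&` [set w | tau i.+1 w <= t].

(** The indicator includes [spaced], so that the geometric domination
    [discount_bounds] holds everywhere and not just almost surely. *)
Definition discount t i w : R := \1_(paid t i) w * expR (- r * tau i.+1 w).

Lemma discount_in t i w : paid t i w -> discount t i w = expR (- r * tau i.+1 w).
Proof. by move=> p; rewrite /discount indicE mem_set// mul1r. Qed.

Lemma discount_out t i w : ~ paid t i w -> discount t i w = 0.
Proof. by move=> p; rewrite /discount indicE memNset// mul0r. Qed.

Lemma measurable_paid t i : measurable (paid t i : set T2).
Proof.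
apply: measurableI; first exact: measurable_spaced_count.
by apply: measurable_le; exact: measurable_arrival_count.
Qed.

Lemma measurable_discount t i : measurable_fun setT (discount t i : T2 -> R).
Proof.
apply: measurable_funM.
  by apply: measurable_indic; exact: measurable_paid.
apply: measurableT_comp => //; apply: measurable_funM => //.
exact: measurable_arrival_count.
Qed.

Lemma discount_bounds t i w : 0 <= discount t i w <= rho ^+ i * discount t 0%N w.
Proof.
have rho0 : 0 <= rho by exact: expR_ge0.
have d0 j : 0 <= discount t j w.
  have [p|p] := pselect (paid t j w); first by rewrite discount_in// expR_ge0.
  by rewrite discount_out.
rewrite d0/=; have [p|p] := pselect (paid t i w); last first.
  by rewrite (discount_out p) mulr_ge0// exprn_ge0.
have [sw it] := p.
have p0 : paid t 0%N w.
  by split => //=; apply: le_trans it; exact: le_arrival.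
rewrite !discount_in// /rho -expRM_natl -expRD ler_expR.
have := spaced_arrival 1 i sw; rewrite add1n -(ler_pM2l r_gt0).
by rewrite -mulr_natl; lra.
Qed.

Lemma discount_le1 t i w : discount t i w <= 1.
Proof.
have [p|p] := pselect (paid t i w); last by rewrite discount_out.
rewrite discount_in// expR_le1 mulNr oppr_le0 mulr_ge0 ?(ltW r_gt0)//.
exact: arrival_ge0.
Qed.

(** An upper bound for the number of arrivals before t on [spaced]; it turns the
    random number of claims into a deterministic one. *)
Definition max_count t : nat := (Num.truncn (t / eps)).+1.

Lemma discount_max_count t i w : 0 <= t -> (max_count t <= i)%N -> discount t i w = 0.
Proof.
move=> t0 ti; apply: discount_out => -[sw /=]; rewrite leNgt => /negP; apply.
by apply: spaced_arrival_gt sw _ => //; exact: leqW.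
Qed.

Lemma discounted_claimsE t w : 0 <= t -> spaced theta eps w ->
  discounted_claims X theta r t w =
    \sum_(i < max_count t) discount t i w *: (X i w : 'rV[R]_d).
Proof.
move=> t0 sw; rewrite /discounted_claims; set k := Num.truncn _.
have kP i : (i < k)%N <-> tau i.+1 w <= t.
  have fN : renewal_count theta t w \is a fin_num.
    rewrite fin_numElt; apply/andP; split.
      apply: (@lt_le_trans _ _ 0%:E); first by rewrite ltNyr.
      by apply: (arrival_le_count theta_ge0 0%N w t0).1; rewrite /arrival big_ord0.
    apply: (@le_lt_trans _ _ (max_count t)%:R%:E); last by rewrite ltry.
    apply: ge_ereal_sup => _ [n /= nt <-]; rewrite lee_fin ler_nat leqNgt.
    apply/negP => tn; move: nt; rewrite leNgt => /negP; apply.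
    by apply: spaced_arrival_gt sw _ => //; exact: ltnW.
  by rewrite /k truncn_gt_nat -lee_fin fineK// arrival_le_count.
have kn : (k <= max_count t)%N.
  rewrite leqNgt; apply/negP => /kP; rewrite leNgt => /negP; apply.
  exact: spaced_arrival_gt sw _.
rewrite (big_ord_widen _ (fun i => expR (- r * tau i.+1 w) *: (X i w : 'rV[R]_d)) kn).
rewrite big_mkcond; apply: eq_bigr => i _; case: ifPn => [/kP it|ik].
  by rewrite discount_in.
rewrite discount_out ?scale0r// => -[_ /= it].
by move/negP: ik; apply; apply/kP.
Qed.

Definition ruin x t : set Omega := [set w | dilate x A (discounted_claims X theta r t w)].

(** The event is split according to the number of claims, which leaves sums of
    a fixed number of terms. *)
Lemma measurable_ruin x t : 0 < x -> measurable (ruin x t).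
Proof.
move=> x0.
pose N w : R := fine (renewal_count theta t w).
have mN : measurable_fun setT N.
  by apply: measurableT_comp => //; exact: measurable_renewal_count.
pose S n w : 'rV[R]_d := \sum_(i < n) expR (- r * tau i.+1 w) *: (X i w : 'rV[R]_d).
have -> : ruin x t = \bigcup_n ([set w | Num.truncn (N w) = n] `&` (S n @^-1` dilate x A)).
  apply/seteqP; split => w; first by move=> xD; exists (Num.truncn (N w)).
  by move=> [n _ [/= <-]].
apply: bigcupT_measurable => n; apply: measurableI.
  have mt : measurable [set y : R | Num.truncn y = n].
    case: n => [|n].
      rewrite (_ : mkset _ = `]-oo, 1[%classic)//; apply/seteqP; split => y /=.
        by rewrite in_itv/= => /eqP; rewrite -leqn0 truncn_le_nat.
      by rewrite in_itv/= => ?; apply/eqP; rewrite -leqn0 truncn_le_nat.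
    rewrite (_ : mkset _ = `[n.+1%:R, n.+2%:R[%classic)//; apply/seteqP; split => y /=.
      rewrite in_itv/= => E; rewrite -truncn_gt_nat -truncn_le_nat E.
      by rewrite !leqnn.
    by rewrite in_itv/= => /truncn_def.
  by rewrite -[X in measurable X]setTI; exact: (mN measurableT _ mt).
apply: measurable_rV; last by apply: open_dilate => //; case: hA.
move=> j; have -> : (fun w => S n w ord0 j) =
    (fun w => \sum_(i < n) expR (- r * tau i.+1 w) * (X i w : 'rV[R]_d) ord0 j).
  by apply/funext => w; rewrite summxE; apply: eq_bigr => i _; rewrite mxE.
apply: measurable_sum => i; apply: measurable_funM; last exact: measurable_coord.
by apply: measurableT_comp => //; apply: measurable_funM.
Qed.

Lemma ruin_sub_sum x t : 0 <= t -> 0 < x ->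
  ruin x t `&` spaced theta eps `<=`
  [set w | x < wsum Yf (fun i => discount t i w) 0 (max_count t) w].
Proof.
move=> t0 x0 w [/= + sw]; rewrite /ruin/= discounted_claimsE//.
have d0 i : 0 <= discount t i w by case/andP: (discount_bounds t i w).
have dX i : nonneg_rV (discount t i w *: (X i w : 'rV[R]_d)).
  by apply: nonneg_rVZ => //; exact: X_ge0.
move=> /(dilateP hA (nonneg_rV_sum _ dX) x0)/lt_le_trans; apply.
exact: (@radial_sum _ _ A hA _ (fun i => discount t i w)
  (fun i => X i w : 'rV[R]_d) d0 (fun i => X_ge0 i w)).
Qed.

Lemma jump_sub_ruin x t : 0 <= t -> 0 < x ->
  [set w | exists2 i, (i < max_count t)%N & x < discount t i w * Yf i w] `<=` ruin x t.
Proof.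
move=> t0 x0 w [i it xd].
have d0 j : 0 <= discount t j w by case/andP: (discount_bounds t j w).
have [sw _] : paid t i w.
  apply: contrapT => np; move: xd; rewrite (discount_out np) mul0r.
  by move=> /lt_trans/(_ x0); rewrite ltxx.
rewrite /ruin/= discounted_claimsE//.
exact: (@le_radial_sum _ _ A hA _ (fun j => discount t j w)
  (fun j => X j w : 'rV[R]_d) _ _ d0 (fun j => X_ge0 j w) it x0 xd).
Qed.

Lemma count_claims_independent : independent_pair P (id : Omega -> T2) (id : Omega -> T1).
Proof. by move=> B C mB mC; rewrite setIC [LHS]X_N_independent// muleC. Qed.

Lemma measurable_id_claims : measurable_fun setT (id : Omega -> T1).
Proof. by apply: measurable_to_generated => i _; exact: measurable_funPT. Qed.

(** The arrival times w are frozen while the claims w' are integrated out. *)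
Lemma randomize (E : set (T2 * T1)) : measurable E ->
  measurable_fun setT (fun w : Omega => P [set w' | E (w, w')]) /\
  P [set w | E (w, w)] = (\int[P]_w P [set w' | E (w, w')])%E.
Proof.
move=> mE; apply: (@independent_slices _ _ _ P _ _ T2 T1 id id E) => //.
- exact: measurable_id_count.
- exact: measurable_id_claims.
- exact: count_claims_independent.
Qed.

Lemma measurable_discounted_size t i :
  measurable_fun setT (fun p : T2 * T1 => discount t i p.1 * Yf i p.2).
Proof.
apply: measurable_funM.
  exact: (measurableT_comp (measurable_discount t i) measurable_fst).
have mY : measurable_fun setT (Yf i : T1 -> R).
  have mX : measurable_fun setT (Xf i : T1 -> borel_rV R d) by exact: measurable_generated.
  exact: (measurableT_comp (measurable_radial hA) mX).
exact: (measurableT_comp mY measurable_snd).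
Qed.

Let jumped x t i := [set p : T2 * T1 | x < discount t i p.1 * Yf i p.2].

Let measurable_jumped x t i : measurable (jumped x t i).
Proof. by apply: measurable_gt; exact: measurable_discounted_size. Qed.

Definition jump_prob x t i w : R := pr P [set w' | x < discount t i w * Yf i w'].

Let mdiag (E : set (T2 * T1)) : measurable E -> measurable [set w : Omega | E (w, w)].
Proof.
move=> mE; rewrite -[X in measurable X]setTI.
have mp : measurable_fun setT (fun w : Omega => (w, w) : T2 * T1).
  apply/measurable_fun_pairP; split; first exact: measurable_id_count.
  exact: measurable_id_claims.
exact: (mp measurableT _ mE).
Qed.

Let mslice (E : set (T2 * T1)) w : measurable E -> measurable [set w' : Omega | E (w, w')].
Proof.
move=> mE; rewrite -[X in measurable X]setTI.
have mp : measurable_fun setT (fun w' : Omega => (w, w') : T2 * T1).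
  apply/measurable_fun_pairP; split; first exact: (@measurable_cst _ _ _ T2 _ w).
  exact: measurable_id_claims.
exact: (mp measurableT _ mE).
Qed.

Let mY i : measurable_fun setT (Yf i) := measurable_funPT (claim_size i).

Let mcY (k : R) i : measurable_fun setT (fun w => k * Yf i w).
Proof. by apply: measurable_funM. Qed.

Lemma jump_probE x t i w : P [set w' | x < discount t i w * Yf i w'] = (jump_prob x t i w)%:E.
Proof. by rewrite prE//; exact/measurable_gt/mcY. Qed.

Lemma measurable_jump_prob x t i : measurable_fun setT (fun w => (jump_prob x t i w)%:E).
Proof.
have [m _] := randomize (measurable_jumped x t i).
rewrite (_ : (fun w => _) = fun w : Omega => P [set w' | jumped x t i (w, w')])//.
by apply/funext => w; rewrite -jump_probE.
Qed.

Lemma jump_prob_ge0 x t i w : 0 <= jump_prob x t i w.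
Proof. exact: pr_ge0. Qed.

Lemma jump_prob_le1 x t i w : jump_prob x t i w <= 1.
Proof. by apply: pr_le1; exact/measurable_gt/mcY. Qed.

(** The expected number of claims arriving by time t whose discounted size
    exceeds x. *)
Definition mean_jumps x t : \bar R :=
  (\sum_(i < max_count t) \int[P]_w (jump_prob x t i w)%:E)%E.

Lemma integral_jump_prob_fin x t i : (\int[P]_w (jump_prob x t i w)%:E)%E \is a fin_num.
Proof.
rewrite ge0_fin_numE; last by apply: integral_ge0 => w _; rewrite lee_fin jump_prob_ge0.
apply: (@le_lt_trans _ _ (\int[P]_w (cst 1%E w))%E).
  apply: ge0_le_integral => //.
  - by move=> w _; rewrite lee_fin jump_prob_ge0.
  - exact: measurable_jump_prob.
  - by move=> w _; rewrite lee_fin jump_prob_le1.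
by rewrite integral_cst//= probability_setT mule1 ltry.
Qed.

Lemma mean_jumps_fin x t : mean_jumps x t \is a fin_num.
Proof. by apply/sum_fin_numP => i _ _; exact: integral_jump_prob_fin. Qed.

Lemma mean_jumpsE x t : mean_jumps x t =
  (\int[P]_w (\sum_(i < max_count t) jump_prob x t i w)%:E)%E.
Proof.
under [RHS]eq_integral do rewrite -sumEFin.
rewrite ge0_integral_sum//.
- by move=> i; exact: measurable_jump_prob.
- by move=> i w _; rewrite lee_fin jump_prob_ge0.
Qed.

Lemma pr_spaced (B : set Omega) : measurable B -> P B = P (B `&` spaced theta eps).
Proof.
move=> mB; have mS := measurable_spaced theta_ge0 eps.
rewrite {1}(_ : B = (B `&` spaced theta eps) `|` (B `&` ~` spaced theta eps)); last first.
  by rewrite -setIUr setUv setIT.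
have mS' := measurableC mS.
apply: measureU0; [exact: measurableI|exact: measurableI|].
have nS := (negligibleP _ mS').1 (negligible_not_spaced theta_iid theta_gap).
by apply: subset_measure0 nS; [exact: measurableI|exact: mS'|exact: subIsetr].
Qed.

(** For frozen arrival times the weights are deterministic and geometrically
    dominated, and [weighted_one_big_jump] applies with a threshold on x that
    does not depend on them, nor on t.  Integrating over the arrival times gives
    the bounds. *)
Lemma ruin_mean_jumps e : 0 < e -> \forall x \near +oo, forall t, 0 <= t ->
  (1 - e) * fine (mean_jumps x t) <= pr P (ruin x t) <= (1 + e) * fine (mean_jumps x t).
Proof.
move=> e0; case: F_class => V0 Vs Vp.
have H := weighted_one_big_jump claim_size_independent claim_size_law claim_size_ge0 V0 Vs Vp
  rho01 e0.
move: H (near_pinfty_ge (1 : R)); apply: filterS2 => x H x1 t t0.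
have x0 : 0 < x by exact: lt_le_trans x1.
have mR := measurable_ruin t x0.
have mS := measurable_spaced theta_ge0 eps.
have PR := pr_spaced mR.
set n := max_count t in H *.
pose E1 := [set p : T2 * T1 | exists2 i, (i < n)%N & x < discount t i p.1 * Yf i p.2].
pose E2 := [set p : T2 * T1 | x < wsum Yf (fun i => discount t i p.1) 0 n p.2].
have mE1 : measurable E1.
  rewrite (_ : E1 = \bigcup_(i in [set i | (i < n)%N]) jumped x t i).
    by apply: bigcup_measurable => i _; exact: measurable_jumped.
  by apply/seteqP; split => p [i ni ip]; exists i.
have mE2 : measurable E2.
  apply: measurable_gt; apply: measurable_sum => i.
  exact: measurable_discounted_size.
have [m1 R1] := randomize mE1.
have [m2 R2] := randomize mE2.
have J0 w : 0 <= \sum_(i < n) jump_prob x t i w.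
  by apply: sumr_ge0 => i _; exact: jump_prob_ge0.
have mJ : measurable_fun setT (fun w => (\sum_(i < n) jump_prob x t i w)%:E).
  under eq_fun do rewrite -sumEFin.
  by apply: emeasurable_sum => i; exact: measurable_jump_prob.
have dH w := H n (fun i => discount t i w)
  (fun i _ => discount_bounds t i w) (discount_le1 t 0 w).
apply/andP; split.
- have [e1|e1] := leP 1 e.
    apply: (@le_trans _ _ 0); last exact: pr_ge0.
    rewrite mulr_le0_ge0//; first by lra.
    rewrite fine_ge0// sume_ge0// => i _; apply: integral_ge0 => w _.
    by rewrite lee_fin jump_prob_ge0.
  rewrite -lee_fin EFinM fineK ?mean_jumps_fin// -prE//.
  apply: (@le_trans _ _ (P [set w | E1 (w, w)])); last first.
    by rewrite le_measure ?inE//; [exact: mdiag|exact: jump_sub_ruin].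
  rewrite R1 mean_jumpsE -ge0_integralZl//; last 2 first.
  + by move=> w _; rewrite lee_fin.
  + by rewrite lee_fin; lra.
  apply: ge0_le_integral => //.
  + by move=> w _; rewrite mule_ge0 ?lee_fin//; lra.
  + exact: measurable_funeM.
  + by move=> w _; rewrite prE ?lee_fin; [have [] := dH w|exact: mslice].
- rewrite -lee_fin EFinM -prE// fineK ?mean_jumps_fin// PR.
  apply: (@le_trans _ _ (P [set w | E2 (w, w)])).
    rewrite le_measure ?inE//; [exact: measurableI|exact: mdiag|].
    exact: ruin_sub_sum.
  rewrite R2 mean_jumpsE -ge0_integralZl//; last 2 first.
  + by move=> w _; rewrite lee_fin.
  + by rewrite lee_fin; lra.
  apply: ge0_le_integral => //.
  + exact: measurable_funeM.
  + by move=> w _; rewrite prE ?lee_fin; [have [] := dH w|exact: mslice].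
Qed.

Lemma jump_prob_in x t i w : 0 < x -> paid t i w ->
  jump_prob x t i w = tl (x * expR (r * tau i.+1 w)).
Proof.
move=> x0 p; rewrite /jump_prob discount_in// -(pr_tail claim_size_law i).
congr (pr P _); apply/seteqP; split => w' /=;
  by rewrite mulNr expRN [_^-1 * _]mulrC ltr_pdivlMr ?expR_gt0.
Qed.

Lemma jump_prob_out x t i w : 0 < x -> discount t i w = 0 -> jump_prob x t i w = 0.
Proof.
move=> x0 p; rewrite /jump_prob p (_ : [set w' | _] = set0) /pr ?measure0//.
by apply/seteqP; split => // w' /=; rewrite mul0r ltNge (ltW x0).
Qed.

Lemma measurable_tail_scaled x : 0 < x ->
  measurable_fun setT (fun s => (tl (x * expR (r * s)))%:E).
Proof.
move=> x0; apply/measurable_EFinP; apply: nonincreasing_measurable => // s s' ss'.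
by apply: le_tail; rewrite ler_pM2l// ler_expR ler_pM2l.
Qed.

(** The null event excluded by [discount] does not affect the integral. *)
Lemma integral_arrival x t i : 0 < x -> 0 <= t ->
  (\int[distribution P (arrival theta i.+1)]_(s in `[0%R, t])
     (tl (x * expR (r * s)))%:E = \int[P]_w (jump_prob x t i w)%:E)%E.
Proof.
move=> x0 t0.
have mt := measurable_tail_scaled x0.
rewrite ge0_integral_pushforward//; last 2 first.
- exact: measurable_funTS.
- by move=> s _; rewrite lee_fin tail_ge0.
have mD : measurable (tau i.+1 @^-1` `[0, t]%classic).
  by rewrite -[X in measurable X]setTI; exact: measurable_arrival.
rewrite integral_mkcond; apply: ge0_ae_eq_integral => //.
- apply/(measurable_restrictT _ mD); apply: measurable_funTS.
  by apply: measurableT_comp => //; exact: measurable_arrival.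
- exact: measurable_jump_prob.
- by move=> w _; apply: erestrict_ge0 => w' _; rewrite lee_fin tail_ge0.
- by move=> w _; rewrite lee_fin jump_prob_ge0.
apply: negligibleS (negligible_not_spaced theta_iid theta_gap) => w /= nw sw.
apply: nw => _; rewrite /patch; case: ifPn => [|/negP]; rewrite inE/= in_itv/=.
  by move=> /andP[_ it]; rewrite jump_prob_in.
rewrite arrival_ge0//= => it; rewrite jump_prob_out//.
by rewrite discount_out// => -[_ /=].
Qed.

Lemma renewal_integral x t : 0 < x -> 0 <= t ->
  \int[renewal_measure theta]_(s in `[0, t]%classic) fine (F (dilate (x * expR (r * s)) A))
  = fine (mean_jumps x t).
Proof.
move=> x0 t0; congr fine.
under eq_integral do rewrite F_dilate ?mulr_gt0 ?expR_gt0//.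
rewrite ge0_integral_measure_series//; last 2 first.
- by move=> s _; rewrite lee_fin tail_ge0.
- by apply: measurable_funTS; exact: measurable_tail_scaled.
under eq_eseriesr do rewrite integral_arrival//.
rewrite (@nneseries_split _ _ 0 (max_count t)); last first.
  by move=> k _; apply: integral_ge0 => w _; rewrite lee_fin jump_prob_ge0.
rewrite add0n [X in (_ + X)%E]eseries0 ?adde0; first by rewrite big_mkord.
move=> i ni _; apply: integral0_eq => w _.
by rewrite jump_prob_out// discount_max_count.
Qed.

Lemma renewal_fun_gt0 t : 0 <= t ->
  (0 < renewal_fun theta t)%E -> (0 < P [set w | (tau 1 w <= t)%R])%E.
Proof.
move=> t0 N0; rewrite measure_gt0; apply: contraTneq N0 => P0.
have m1 : measurable [set w | tau 1 w <= t] by exact: measurable_le.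
rewrite -leNgt /renewal_fun (@ae_eq_integral _ _ _ P setT (cst 0%E)) ?integral0//.
  exact: measurable_renewal_count.
exists [set w | tau 1 w <= t]; split => //.
move=> w /= nw; rewrite leNgt; apply/negP => tw; apply: nw => _.
apply/eqP; rewrite eq_le; apply/andP; split.
  apply: ge_ereal_sup => _ [[|n] /= nt <-]//.
  by have := lt_le_trans tw (le_trans (le_arrival theta_ge0 w (ltn0Sn n)) nt); rewrite ltxx.
by apply: (arrival_le_count theta_ge0 0%N w t0).1; rewrite /arrival big_ord0.
Qed.

(** A claim arriving by time t exceeds x after discounting with probability at
    least tl (x exp(r t)) > 0. *)
Lemma mean_jumps_gt0 x t : 0 < x -> 0 <= t -> (0 < renewal_fun theta t)%E ->
  0 < fine (mean_jumps x t).
Proof.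
move=> x0 t0 /(renewal_fun_gt0 t0) Pt.
have m1 : measurable [set w | tau 1 w <= t] by exact: measurable_le.
have mp : measurable (paid t 0).
  by apply: measurableI => //; exact: measurable_spaced.
have J0 i : (0 <= \int[P]_w (jump_prob x t i w)%:E)%E.
  by apply: integral_ge0 => w _; rewrite lee_fin jump_prob_ge0.
apply: fine_gt0; apply/andP; split; last first.
  by rewrite -ge0_fin_numE ?mean_jumps_fin// sume_ge0.
rewrite /mean_jumps /max_count big_ord_recl.
apply: (@lt_le_trans _ _ (\int[P]_w (jump_prob x t 0 w)%:E)%E); last first.
  by rewrite leeDl// sume_ge0.
have c0 := tail_gt0 (x * expR (r * t)).
apply: (@lt_le_trans _ _ (\int[P]_w ((tl (x * expR (r * t)))%:E * (\1_(paid t 0) w)%:E))%E).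
  rewrite ge0_integralZl//; last 2 first.
  - by apply/measurable_EFinP; exact: measurable_indic.
  - by rewrite lee_fin ltW.
  rewrite integral_indic// setIT mule_gt0//.
  by move: Pt; rewrite (pr_spaced m1) setIC.
apply: ge0_le_integral => //.
- by move=> w _; rewrite -EFinM lee_fin mulr_ge0// ltW.
- apply/measurable_EFinP; apply: measurable_funM => //.
- exact: measurable_jump_prob.
move=> w _; rewrite -EFinM lee_fin indicE.
have [p|p] := pselect (paid t 0 w); last by rewrite memNset// mulr0 jump_prob_ge0.
rewrite mem_set// mulr1 jump_prob_in//; apply: le_tail.
by rewrite ler_pM2l// ler_expR ler_pM2l//; case: p.
Qed.

(** The supremum over an empty set of times would be -oo, which does not tend
    to 0: some time must be shown to be admissible. *)
Lemma renewal_fun_pos : exists2 t, 0 <= t & (0 < renewal_fun theta t)%E.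
Proof.
have h0 : 0 < 2^-1 :> R by lra.
have [t t0 Ht] := (near_pinftyP _).1 (tail_small (distribution P (theta 0%N)) h0).
exists t; first exact: ltW.
have m1 : measurable [set w | tau 1 w <= t] by exact: measurable_le.
have P1 : 2^-1 <= pr P [set w | tau 1 w <= t].
  have -> : [set w | tau 1 w <= t] = [set w | theta 0%N w <= t].
    by apply/seteqP; split => w /=; rewrite arrivalS /arrival big_ord0 add0r.
  rewrite pr_le_gt; last exact: measurable_funPT.
  have : tail (distribution P (theta 0%N)) t = pr P [set w | t < theta 0%N w].
    apply: (congr1 (fun S => fine (P S))).
    by apply/seteqP; split => w /=; rewrite in_itv/= andbT.
  by have := Ht t (lexx _); lra.
apply: (@lt_le_trans _ _ (\int[P]_w (\1_[set w | tau 1 w <= t] w)%:E)%E).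
  rewrite integral_indic// setIT [ltRHS](prE P m1) lte_fin; lra.
apply: ge0_le_integral => //.
- by apply/measurable_EFinP; exact: measurable_indic.
- exact: measurable_renewal_count.
move=> w _; rewrite indicE; have [p|p] := pselect (tau 1 w <= t).
  by rewrite mem_set//; apply: (arrival_le_count theta_ge0 1%N w (ltW t0)).1.
rewrite memNset//; apply: (arrival_le_count theta_ge0 0%N w (ltW t0)).1.
by rewrite /arrival big_ord0 ltW.
Qed.

Lemma ruin_uniform_equiv :
  uniform_equiv [set t : R | 0 <= t /\ (0 < renewal_fun theta t)%E]
    (fun x t => fine (P (ruin x t)))
    (fun x t => \int[renewal_measure theta]_(s in `[0, t]%classic)
                  fine (F (dilate (x * expR (r * s)) A))).
Proof.
rewrite /uniform_equiv; set E := [set t : R | _].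
pose q x t : \bar R := `|fine (P (ruin x t)) /
  (\int[renewal_measure theta]_(s in `[0, t]%classic)
     fine (F (dilate (x * expR (r * s)) A))) - 1|%:E.
have key e : 0 < e ->
    \forall x \near +oo, (0 <= ereal_sup [set q x t | t in E] <= e%:E)%E.
  move=> e0; move: (ruin_mean_jumps e0) (near_pinfty_ge (1 : R)).
  apply: filterS2 => x H x1; have x0 : 0 < x by exact: lt_le_trans x1.
  apply/andP; split.
    have [t t0 Nt] := renewal_fun_pos.
    apply: (@le_trans _ _ (q x t)); first by rewrite lee_fin.
    by apply: ereal_sup_ubound; exists t.
  apply: ge_ereal_sup => _ [t [t0 Nt] <-].
  rewrite /q renewal_integral// lee_fin.
  have g0 := mean_jumps_gt0 x0 t0 Nt.
  have /andP[H1 H2] := H t t0.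
  rewrite ler_distl; apply/andP; split.
    by rewrite ler_pdivlMr.
  by rewrite ler_pdivrMr.
apply/fine_cvgP; split.
  apply: filterS (key 1 ltr01) => x /andP[s0 s1].
  by rewrite ge0_fin_numE// (le_lt_trans s1)// ltry.
apply/cvgrPdist_le => e e0; apply: filterS (key e e0) => x /andP[s0 s1] /=.
rewrite sub0r normrN ger0_norm ?fine_ge0//.
rewrite -lee_fin fineK//.
by rewrite ge0_fin_numE// (le_lt_trans s1)// ltry.
Qed.

End discounted.

Theorem theorem3p2 (R : realType) (d : nat) (hd : (0 < d)%N)
  (A : set 'rV[R]_d) (hA : risk_set A)
  (dO : measure_display) (Omega : measurableType dO) (P : probability Omega R)
  (F : probability (borel_rV R d) R)
  (X : nat -> {RV P >-> borel_rV R d}) (theta : nat -> {RV P >-> R}) (r : R)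
  (X_ge0 : forall i w, nonneg_rV (X i w))
  (X_neq0 : forall i w, (X i w : 'rV[R]_d) != 0)
  (X_iid : iid X)
  (X_law : forall B : set (borel_rV R d),
     measurable B -> P (X 0%N @^-1` B) = F B)
  (theta_ge0 : forall i w, 0 <= theta i w)
  (theta_nondegenerate : (P [set w | theta 0%N w = 0%R] < 1)%E)
  (theta_iid : iid theta)
  (renewal_finite : forall t : R, 0 <= t -> (renewal_fun theta t < +oo)%E)
  (X_N_independent : independent_systems P (sigma_of setT X)
     (sigma_of [set t : R | 0 <= t] (renewal_count theta)))
  (F_class : multivariate_class_A hA F)
  (theta_gap : exists2 eps : R, 0 < eps & P [set w | (eps < theta 0%N w)%R] = 1%E)
  (r_gt0 : 0 < r) :
  uniform_equiv [set t : R | 0 <= t /\ (0 < renewal_fun theta t)%E]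
    (fun x t => fine (P [set w | dilate x A (discounted_claims X theta r t w)]))
    (fun x t => \int[renewal_measure theta]_(s in `[0, t]%classic)
                  fine (F (dilate (x * expR (r * s)) A))).
Proof.
have [eps eps0 gap] := theta_gap.
exact: (ruin_uniform_equiv X_ge0 X_iid X_law theta_ge0 theta_iid X_N_independent
  F_class eps0 gap r_gt0).
Qed.
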